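(* Let $p$ be a prime, let $F$ be the field with $p$ elements, let $\bar F$ be an algebraic closure of $F$, and let $G$ be a finite group. (a) The map $\Sigma:\mathrm{ITS}(\bar F G)\to\mathrm{ITS}(FG)$, defined for $X\in\mathrm{ITS}(\bar F G)$ by $\Sigma(X)=W\in\mathrm{ITS}(FG)$ if there is a $(K,V)\in\mathcal{E}(W)$ such that $V\otimes_K\bar F\cong X$ as $\bar F G$-modules, is well-defined (that is, for each $X$ there is exactly one such $W$). Moreover, if $\Sigma(X)=W$, $(K,V)\in\mathcal{E}(W)$ satisfies $V\otimes_K\bar F\cong X$, and $Q$ is a vertex of $W$, then $V\in\mathrm{ITS}(KG)$ and $Q$ is a vertex of $V$ and of $X$; and if $H=N_G(Q)$ and $(Q,\mathscr{V})$ (resp. $(Q,\mathscr{Y})$) is a vertex-source pair of $V$ (resp. $X$), then $\mathscr{Y}^h\mid\mathscr{V}\otimes_K\bar F$ as $\bar F Q$-modules for some $h\in H$, and $\mathrm{Gr}_G^H(X)\mid\mathrm{Gr}_G^H(V)\otimes_K\bar F$ as $\bar F H$-modules. (b) $\Sigma^{-1}(W)\neq\varnothing$ for all $W\in\mathrm{ITS}(FG)$. (c) $\mathrm{ITS}(\bar F G)=\bigcup_{W\in\mathrm{ITS}(FG)}\Sigma^{-1}(W)$ is a partition of $\mathrm{ITS}(\bar F G)$.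
   Context: All modules are finitely generated unitary right modules, and isomorphic modules are identified. For a subfield $K$ of $\bar F$, $\mathrm{ITI}(KG)$ (resp. $\mathrm{ITS}(KG)$) denotes a set of representatives of the isomorphism types of indecomposable (resp. simple) $KG$-modules, with $\mathrm{ITS}(KG)\subseteq\mathrm{ITI}(KG)$. For modules $U,V$ over a ring, $U\mid V$ means that $U$ is isomorphic to a direct summand of $V$. For $W\in\mathrm{ITI}(FG)$ define $$\mathcal{E}(W)=\{(K,V)\mid K \text{ is a finite subfield of }\bar F,\ V\in\mathrm{ITI}(KG),\ V\mid W\otimes_F K \text{ as } KG\text{-modules}\}.$$ $\Sigma^{-1}(W)$ denotes the fibre $\{X\in \mathrm{ITS}(\bar F G)\mid \Sigma(X)=W\}$. A vertex-source pair $(Q,\mathscr{V})$ of an indecomposable $KG$-module $V$ consists of a vertex $Q$ of $V$ and an indecomposable $KQ$-module $\mathscr{V}$ that is a $Q$-source of $V$. For $h\in H=N_G(Q)$, $\mathscr{Y}^h$ is the conjugate of the $\bar F Q$-module $\mathscr{Y}$ by $h$, again an $\bar F Q$-module. For a subfield $K$ of $\bar F$, $\mathrm{Gr}_G^H$ denotes the Green correspondence from $G$ to $H=N_G(Q)$, sending an indecomposable $KG$-module with vertex $Q$ to its Green correspondent, an indecomposable $KH$-module with vertex $Q$. *)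

(* Defs.v *)
(* A finitely generated right KG-module is a matrix representation            *)
(* [V : representation K G] ([V g] acts on row vectors by right               *)
(* multiplication), and isomorphism of modules is [mx_rsim].                  *)
From HB Require Import structures.
From mathcomp Require Import all_boot all_order all_algebra all_fingroup.
From mathcomp Require Import mxrepresentation character.
From mathcomp Require Import boolp classical_sets cardinality.

Set Implicit Arguments.
Unset Strict Implicit.
Unset Printing Implicit Defensive.

Import GRing.Theory.
Local Open Scope classical_set_scope.
Local Open Scope ring_scope.

Section Subfields.

Variables (E : fieldType) (K : divringClosed E).

(* The carrier of the subfield K of E, as a field in its own right; the       *)
(* inclusion into E is [val].                                                 *)
Record subfield := InSubfield { subfield_val :> E; _ : subfield_val \in K }.

HB.instance Definition _ := [isSub for subfield_val].
HB.instance Definition _ := [Choice of subfield by <:].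
HB.instance Definition _ := [SubChoice_isSubIntegralDomain of subfield by <:].
HB.instance Definition _ := [SubIntegralDomain_isSubField of subfield by <:].

Variables (p : nat) (iota : {rmorphism 'F_p -> E}).

(* The inclusion of the prime field into K: [iota] with codomain restricted   *)
(* to K (the default value of [insubd] is never used, see [val_prime_incl]).  *)
Definition prime_incl (x : 'F_p) : subfield := insubd (0 : subfield) (iota x).

Lemma val_prime_incl x : val (prime_incl x) = iota x.
Proof. by rewrite insubdK // -[x]natr_Zp rmorph_nat; apply: rpred_nat. Qed.

Fact prime_incl_zmod_morphism : zmod_morphism prime_incl.
Proof.
by move=> x y; apply: val_inj; rewrite rmorphB /= !val_prime_incl rmorphB.
Qed.

Fact prime_incl_monoid_morphism : monoid_morphism prime_incl.
Proof.
split=> [|x y]; apply: val_inj; first by rewrite val_prime_incl !rmorph1.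
by rewrite rmorphM /= !val_prime_incl rmorphM.
Qed.

HB.instance Definition _ :=
  GRing.isZmodMorphism.Build 'F_p subfield prime_incl prime_incl_zmod_morphism.
HB.instance Definition _ :=
  GRing.isMonoidMorphism.Build 'F_p subfield prime_incl
    prime_incl_monoid_morphism.

End Subfields.

Section Modules.

Variables (gT : finGroupType) (K : fieldType).
Implicit Types G H Q : {group gT}.

Definition iso G (U V : representation K G) : Prop := mx_rsim U V.

Definition divides G (U V : representation K G) : Prop :=
  exists U' : representation K G, iso V (dadd_grepr U U').

Definition simple G (V : representation K G) : Prop := mx_irreducible V.

Definition indecomposable G (V : representation K G) : Prop :=
  (0 < rdegree V)%N /\
  forall U U' : representation K G, iso V (dadd_grepr U U') ->
    rdegree U = 0%N \/ rdegree U' = 0%N.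

(* A contains exactly one module of each isomorphism type of modules with     *)
(* the property P, and nothing else.                                          *)
Definition representatives G (P : representation K G -> Prop)
    (A : set (representation K G)) : Prop :=
  [/\ forall V, A V -> P V,
      forall V, P V -> exists2 U, A U & iso U V
    & forall U V, A U -> A V -> iso U V -> U = V].

Definition Res G H (sHG : H \subset G) (V : representation K G) :
    representation K H :=
  Representation (subg_repr V sHG).

Section Induction.

Variables (G H : {group gT}) (V : representation K H).

Definition coset_rep (i : 'I_#|rcosets H G|) : gT := repr (enum_val i).

(* V (x)_KH KG is the direct sum of the V (x) t for t in a transversal of the *)
(* right cosets of H in G, and (v (x) t) g = v (t g t'^-1) (x) t' where t' is *)
(* the element of the transversal with t g in H t'.                           *)
Definition Ind_mx (g : gT) : 'M[K]_(\sum_(i < #|rcosets H G|) rdegree V) :=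
  \mxblock_(i < #|rcosets H G|, j < #|rcosets H G|)
    let x := (coset_rep i * g * (coset_rep j)^-1)%g in
    if x \in H then V x else 0.

Lemma rcoset_coset_rep i : (H :* coset_rep i)%g = enum_val i.
Proof.
by have /rcosetsP[x _ eqHx] := enum_valP i; rewrite /coset_rep eqHx rcoset_repr.
Qed.

Hypothesis sHG : H \subset G.

Lemma coset_rep_in i : coset_rep i \in G.
Proof.
have /rcosetsP[x Gx eqHx] := enum_valP i.
rewrite /coset_rep eqHx; have /rcosetP[h Hh ->] := mem_repr_rcoset H x.
by rewrite groupM // (fintype.subsetP sHG).
Qed.

Lemma coset_rep_eq i j : (coset_rep i * (coset_rep j)^-1 \in H)%g = (i == j).
Proof.
rewrite -mem_rcoset; apply/idP/eqP=> [|->]; last exact: rcoset_refl.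
by move/rcoset_eqP; rewrite !rcoset_coset_rep => /enum_val_inj.
Qed.

Lemma coset_rep_ex g : g \in G -> exists j, (g * (coset_rep j)^-1 \in H)%g.
Proof.
move=> Gg; have HgG: (H :* g)%g \in rcosets H G by apply/rcosetsP; exists g.
exists (enum_rank_in HgG (H :* g)%g); rewrite -mem_rcoset rcoset_coset_rep.
by rewrite enum_rankK_in // rcoset_refl.
Qed.

Fact Ind_mx_repr : mx_repr G Ind_mx.
Proof.
split=> [|g h Gg Gh].
  rewrite -mxdiagZ; apply: eq_mxblock => i j /=.
  rewrite mulg1 coset_rep_eq; case: eqVneq => [->|//].
  by rewrite mulgV repr_mx1 conform_mx_id.
rewrite /Ind_mx mul_mxblock; apply: eq_mxblock => i k /=.
have [j Hij] := coset_rep_ex (groupM (coset_rep_in i) Gg).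
have Eik : (coset_rep i * (g * h) * (coset_rep k)^-1)%g =
    (coset_rep i * g * (coset_rep j)^-1 * (coset_rep j * h * (coset_rep k)^-1))%g.
  by rewrite !mulgA mulgKV.
rewrite (bigD1 j) //= Hij big1 ?addr0 => [|l neq_lj]; last first.
  case: ifP => [Hil|]; last by rewrite mul0mx.
  case/eqP: neq_lj; apply/eqP; rewrite eq_sym -coset_rep_eq.
  by have:= groupM (groupVr Hij) Hil; rewrite !invMg !invgK !mulgA mulgKV mulgKV.
rewrite Eik groupMl //; case: ifP => [Hjk|_]; last by rewrite mulmx0.
exact: repr_mxM.
Qed.

Definition Ind : representation K G :=
  Representation (MxRepresentation Ind_mx_repr).

End Induction.

Section Conjugation.

Variables (Q : {group gT}) (h : gT) (nQh : h \in 'N(Q)%g).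
Variable Y : representation K Q.

(* The module Y^h = Y (x) h inside Y (x)_KQ K[N(Q)]: (y (x) h) q is           *)
(* (y (h q h^-1)) (x) h.                                                      *)
Definition conj_mx (q : gT) : 'M[K]_(rdegree Y) := Y (q ^ h^-1)%g.

Fact conj_mx_repr : mx_repr Q conj_mx.
Proof.
have nQV q : q \in Q -> (q ^ h^-1)%g \in Q by rewrite memJ_norm ?groupV.
split=> [|x y Qx Qy]; first by rewrite /conj_mx conj1g repr_mx1.
by rewrite /conj_mx conjMg repr_mxM ?nQV.
Qed.

Definition conj_mod : representation K Q :=
  Representation (MxRepresentation conj_mx_repr).

End Conjugation.

Definition rel_projective G Q (sQG : Q \subset G) (V : representation K G) :
    Prop :=
  exists S : representation K Q, divides V (Ind S sQG).

Definition vertex G Q (V : representation K G) : Prop :=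
  exists sQG : Q \subset G, rel_projective sQG V /\
    forall (R : {group gT}) (sRG : R \subset G),
      R \subset Q -> rel_projective sRG V -> R = Q.

Definition source G Q (V : representation K G) (S : representation K Q) :
    Prop :=
  indecomposable S /\ exists sQG : Q \subset G, divides V (Ind S sQG).

Definition vertex_source_pair G Q (V : representation K G)
    (S : representation K Q) : Prop :=
  vertex Q V /\ source V S.

Definition green_correspondent G Q (V : representation K G)
    (U : representation K 'N_G(Q)%G) : Prop :=
  [/\ indecomposable U, vertex Q U & divides U (Res (subsetIl G 'N(Q)%g) V)].

(* When V is indecomposable with vertex Q, exactly one isomorphism type       *)
(* satisfies [green_correspondent], by Green's theorem; the zero module is    *)
(* the default value elsewhere.                                               *)
Definition Gr G Q (V : representation K G) : representation K 'N_G(Q)%G :=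
  if pselect (exists U, green_correspondent V U) is left exU
  then sval (cid exU) else grepr0.

End Modules.

(* L (x)_K V along the embedding f of K into L.                               *)
Definition extend (gT : finGroupType) (G : {group gT}) (K L : fieldType)
    (f : {rmorphism K -> L}) (V : representation K G) : representation L G :=
  Representation (map_repr f V).

Section FiniteForms.

Variables (p : nat) (Fbar : fieldType) (iota : {rmorphism 'F_p -> Fbar}).
Variables (gT : finGroupType) (G : {group gT}).
Variable ITI : forall K : fieldType, set (representation K G).

(* [calE W V], for V over the subfield K, says that (K, V) belongs to E(W).   *)
Definition calE (W : representation 'F_p G) (K : divringClosed Fbar)
    (V : representation (subfield K) G) : Prop :=
  [/\ finite_set [set x | x \in K], ITI V
    & divides V (extend (prime_incl K iota) W)].

Definition Sigma_rel (X : representation Fbar G) (W : representation 'F_p G) :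
    Prop :=
  exists (K : divringClosed Fbar) (V : representation (subfield K) G),
    calE W V /\ iso (extend val V) X.

End FiniteForms.

(* Main.v *)
From HB Require Import structures.
Require Import Defs.
From mathcomp Require Import all_boot all_order all_algebra all_fingroup.
From mathcomp Require Import finfield mxrepresentation character.
From mathcomp Require Import boolp classical_sets cardinality.

Set Implicit Arguments.
Unset Strict Implicit.
Unset Printing Implicit Defensive.

Import GRing.Theory.
Local Open Scope ring_scope.

(** The whole theorem rests on one reformulation: Sigma X = W holds exactly
    when X is a direct summand of the scalar extension of W to the algebraic
    closure.  One direction is a base change ([divides_of_extend]).  For the
    other, the entries of X and of the two maps that split it off are algebraic
    over the prime field, so they lie in a finite subfield K, and the whole
    splitting descends to K ([divides_finite_subfield]).

    With that, Sigma is well defined and onto.  Uniqueness of W: a nonzero map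
    between the extensions of W and W' yields a nonzero map from W to W',
    because Hom commutes with field extension ([hom_descent]), and then Schur's
    lemma applies.  Existence of W: passing from the regular module to smaller
    and smaller submodules and quotients, one reaches a simple W whose extension
    has a nonzero map to X ([exists_simple_below]); this map splits because the
    extension of a simple module of the prime field is semisimple
    ([simple_extend_reducible]).  The reason is Galois descent: a nonzero
    submodule stable under Frobenius contains a nonzero vector over the prime
    field, so it is everything, and a maximal sum of submodules of least
    dimension is stable under Frobenius.  The same semisimplicity shows that
    Sigma is onto.

    Vertices, sources and Green correspondents are handled through the relative
    trace Tr_R^G : End_R(V) -> End_G(V).  By Higman's criterion
    ([rel_projectiveP]), V is relatively R-projective iff 1 is a relative trace.
    The relative traces form an ideal of End_G(V); so when V is simple,
    Schur's lemma makes V relatively R-projective as soon as one relative trace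
    is nonzero.  This last condition is linear, hence insensitive to field
    extension, and therefore W, V and X are projective relative to the same
    subgroups and have the same vertices
    ([rel_projective_simple_extend]).

    For sources, the source of X and the extended source of V both induce
    modules having X as a summand.  A summand S of the restriction of X to Q is
    chosen on which the trace to G does not vanish.  Mackey's formula applied to
    1 = Tr_Q^G(ab), together with the locality of End_Q(S) (Fitting), shows that
    S is, up to conjugation in the normalizer, a summand of every T such that X
    divides Ind T ([source_summand_conj]); comparing two such T through S gives
    the claim ([sources_conj]).

    For the Green correspondence let H = N_G(Q).  Mackey's formula gives
    Tr_Q^G = Tr_Q^H modulo traces from subgroups not containing Q
    ([trace_normalizer]), and such traces are non-units on an indecomposable
    H-module of vertex Q ([normal_vertex_trace]).  If e projects V on its Green
    correspondent Z, and 1 = Tr_Q^G(A), then Tr_Q^G(eAe) is a nonzero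
    endomorphism of the simple module V, hence invertible.  Modulo non-units on
    the Green correspondent U of X, the identity of U thus factors through the
    extension of Z, so U is a summand of it ([green_correspondent_extend]). *)

(** * Intertwining matrices and direct summands *)

Section Homs.

Variables (gT : finGroupType) (K : fieldType).

(** U and V are mere matrix-valued functions, so that a module for a group can
    also be regarded, without any change of type, as a module for each of its
    subgroups L. *)
Definition mxhom (L : {set gT}) n m (U : gT -> 'M[K]_n) (V : gT -> 'M[K]_m)
    (A : 'M[K]_(n, m)) : Prop :=
  forall g, g \in L -> U g *m A = A *m V g.

Lemma hom0 (L : {set gT}) n m (U : gT -> 'M[K]_n) (V : gT -> 'M[K]_m) :
  mxhom L U V 0.
Proof. by move=> g _; rewrite mulmx0 mul0mx. Qed.

Lemma hom1 (L : {set gT}) n (U : gT -> 'M[K]_n) : mxhom L U U 1%:M.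
Proof. by move=> g _; rewrite mulmx1 mul1mx. Qed.

Lemma homD (L : {set gT}) n m (U : gT -> 'M[K]_n) (V : gT -> 'M[K]_m) A B :
  mxhom L U V A -> mxhom L U V B -> mxhom L U V (A + B).
Proof. by move=> hA hB g Lg; rewrite mulmxDr mulmxDl hA ?hB. Qed.

Lemma hom_sum (L : {set gT}) n m (U : gT -> 'M[K]_n) (V : gT -> 'M[K]_m)
    (I : finType) (P : pred I) (A : I -> 'M[K]_(n, m)) :
  (forall i, P i -> mxhom L U V (A i)) -> mxhom L U V (\sum_(i | P i) A i).
Proof.
by move=> hA; elim/big_ind: _ => // [|*]; [apply: hom0 | apply: homD].
Qed.

Lemma homM (L : {set gT}) n m k (U : gT -> 'M[K]_n) (V : gT -> 'M[K]_m)
    (W : gT -> 'M[K]_k) A B :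
  mxhom L U V A -> mxhom L V W B -> mxhom L U W (A *m B).
Proof. by move=> hA hB g Lg; rewrite mulmxA hA // -mulmxA hB // mulmxA. Qed.

Lemma homV (L : {set gT}) n (U V : gT -> 'M[K]_n) A :
  A \in unitmx -> mxhom L U V A -> mxhom L V U (invmx A).
Proof.
by move=> uA hA g Lg; apply: (canRL (mulKmx uA)); rewrite mulmxA -hA // mulmxK.
Qed.

Lemma hom_sub (L M : {set gT}) n m (U : gT -> 'M[K]_n) (V : gT -> 'M[K]_m) A :
  M \subset L -> mxhom L U V A -> mxhom M U V A.
Proof. by move=> sML hA g Mg; apply: hA; apply: (fintype.subsetP sML). Qed.

Variable G : {group gT}.

Lemma isoP (U V : representation K G) :
  iso U V <-> exists A B, [/\ mxhom G U V A, mxhom G V U B, A *m B = 1%:M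
                           & B *m A = 1%:M].
Proof.
split=> [|[A [B [hA hB AB BA]]]].
  case: U V => n U [m V] [/= A eq_nm]; subst m.
  rewrite row_free_unit => uA hA; exists A, (invmx A).
  by split; rewrite ?mulmxV ?mulVmx //; apply: homV.
exists A => //; last by apply/row_freeP; exists B.
apply/eqP; rewrite eqn_leq.
have /mulmx1_min -> := AB; have /mulmx1_min -> // := BA.
Qed.

Lemma iso_sym (U V : representation K G) : iso U V -> iso V U.
Proof. exact: mx_rsim_sym. Qed.

Lemma kermx_module (U V : representation K G)
    (A : 'M_(rdegree U, rdegree V)) :
  mxhom G U V A -> mxmodule U (kermx A).
Proof.
move=> hA; apply/mxmoduleP=> g Gg; apply/sub_kermxP.
by rewrite -mulmxA hA // mulmxA mulmx_ker mul0mx.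
Qed.

Lemma hom_val_submod n (W : 'M[K]_n)
  (rW : mx_representation K G n) (modW : mxmodule rW W) :
  mxhom G (submod_repr modW) rW (val_submod 1%:M).
Proof.
by move=> g Gg; rewrite -val_submodJ // mul1mx -val_submodE.
Qed.

Lemma iso_dadd_split (M U V : representation K G) :
  iso M (dadd_grepr U V) ->
  exists i q j r,
    [/\ mxhom G U M i, mxhom G M U q, mxhom G V M j & mxhom G M V r] /\
    [/\ i *m q = 1%:M, j *m r = 1%:M & q *m i + r *m j = 1%:M].
Proof.
case/isoP=> A [B [hA hB AB BA]].
exists (row_mx 1%:M 0 *m B), (A *m col_mx 1%:M 0).
exists (row_mx 0 1%:M *m B), (A *m col_mx 0 1%:M); split; split.
- apply: homM hB => g Gg /=; rewrite mul_mx_row mul_row_block.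
  by rewrite !mulmx0 !mul0mx mulmx1 mul1mx !addr0.
- apply: homM hA _ => g Gg /=; rewrite mul_block_col mul_col_mx.
  by rewrite !mulmx0 !mul0mx mulmx1 mul1mx !addr0.
- apply: homM hB => g Gg /=; rewrite mul_mx_row mul_row_block.
  by rewrite !mulmx0 !mul0mx mulmx1 mul1mx !add0r.
- apply: homM hA _ => g Gg /=; rewrite mul_block_col mul_col_mx.
  by rewrite !mulmx0 !mul0mx mulmx1 mul1mx !add0r.
- by rewrite mulmxA -(mulmxA _ B) BA mulmx1 mul_row_col mulmx1 mulmx0 addr0.
- by rewrite mulmxA -(mulmxA _ B) BA mulmx1 mul_row_col mulmx1 mulmx0 add0r.
rewrite !mulmxA -mulmxDl -!(mulmxA A) -mulmxDr.
rewrite !mul_col_row !mulmx0 !mul0mx mulmx1 add_block_mx !addr0 !add0r.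
by rewrite mulmx1 -scalar_mx_block mulmx1 AB.
Qed.

(** A module with a split embedding A into V is a summand: the complement is
    the kernel of the retraction B. *)
Lemma dividesP (U V : representation K G) :
  divides U V <->
  exists A B, [/\ mxhom G U V A, mxhom G V U B & A *m B = 1%:M].
Proof.
split=> [[U' /iso_dadd_split[A [B [_ [_ [[hA hB _ _] [AB _ _]]]]]]] |].
  by exists A, B.
case=> A [B [hA hB AB]].
have modB := kermx_module hB.
exists (Representation (submod_repr modB)); apply: mx_rsim_sym.
pose C := val_submod (1%:M : 'M_(\rank (kermx B))).
have CB : C *m B = 0 by apply/sub_kermxP; rewrite val_submodP.
exists (col_mx A C) => [||g Gg] /=.
- have rB : \rank B = rdegree U.
    apply/eqP; rewrite eqn_leq rank_leq_col /=.
    by have := mxrankM_maxr A B; rewrite AB mxrank1.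
  by rewrite mxrank_ker rB subnKC // -rB rank_leq_row.
- apply: inj_row_free => w; rewrite -[w]hsubmxK mul_row_col => w0.
  have := congr1 (mulmx^~ B) w0.
  rewrite mul0mx mulmxDl -[_ *m A *m B]mulmxA AB -[_ *m C *m B]mulmxA CB.
  rewrite mulmx0 mulmx1 addr0 => w10.
  move: w0; rewrite w10 mul0mx add0r -val_submodE => /eqP.
  by rewrite val_submod_eq0 => /eqP->; rewrite row_mx0.
- rewrite mul_block_col mul_col_mx !mul0mx addr0 add0r hA //.
  by rewrite (hom_val_submod modB).
Qed.

Lemma divides_trans (U V W : representation K G) :
  divides U V -> divides V W -> divides U W.
Proof.
move=> /dividesP[A [B [hA hB AB]]] /dividesP[A' [B' [hA' hB' AB']]].
apply/dividesP; exists (A *m A'), (B' *m B); split.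
- exact: homM hA hA'.
- exact: homM hB' hB.
by rewrite mulmxA -(mulmxA A) AB' mulmx1.
Qed.

Lemma iso_divides (U V : representation K G) : iso U V -> divides U V.
Proof.
by case/isoP=> A [B [hA hB AB _]]; apply/dividesP; exists A, B.
Qed.

(** * Local endomorphism rings and the choice of indecomposable summands *)

Section Local.

Variable V : representation K G.
Hypothesis indV : indecomposable V.

Local Notation n := (rdegree V).

Lemma indec_degree : (1%:M : 'M[K]_n) != 0.
Proof. by rewrite -mxrank_eq0 mxrank1 -lt0n; case: indV. Qed.

Lemma endo0_nonunit : (0 : 'M[K]_n) \notin unitmx.
Proof.
apply/negP=> u0; have := indec_degree.
by rewrite -(mulVmx u0) mulmx0 eqxx.
Qed.

(** Fitting: when the rank is stable, V is the direct sum of the kernel and the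
    image of B. *)
Lemma endo_stable_rank (B : 'M[K]_n) : mxhom G V V B ->
  \rank (B *m B) = \rank B -> B = 0 \/ B \in unitmx.
Proof.
move=> hB rBB.
have modK := kermx_module hB.
have modI : mxmodule V B.
  by apply/mxmoduleP=> g Gg; rewrite -hB // submxMl.
have dKI : (kermx B :&: B = 0)%MS.
  by rewrite capmxC; apply/eqP; apply/mxrank_injP; rewrite rBB.
have sKI : (kermx B + B :=: 1%:M)%MS.
  apply/eqmxP; rewrite submx1 sub1mx /row_full.
  by rewrite mxrank_disjoint_sum // mxrank_ker subnK ?rank_leq_row ?eqxx.
have dxKI : mxdirect (kermx B + B) by apply/mxdirect_addsP.
pose UK := Representation (submod_repr modK).
pose UI := Representation (submod_repr modI).
have isoV : iso V (dadd_grepr UK UI).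
  apply: mx_rsim_trans (mx_rsim_sym (rsim_submod1 (mxmodule1 V) _)) _ => //.
  apply: (mx_rsim_dadd (modU := modK) (modV := modI) _ sKI dxKI);
    exact: mx_rsim_refl.
case: indV => n0 /(_ _ _ isoV)[/= r0 | /= r0].
  by right; rewrite -row_free_unit -kermx_eq0 -mxrank_eq0 r0.
by left; apply/eqP; rewrite -mxrank_eq0 r0.
Qed.

(** Squaring A repeatedly makes the rank stabilize. *)
Lemma endo_nilp_unit (A : 'M[K]_n) : mxhom G V V A ->
  A \notin unitmx -> exists k, A ^+ k = 0.
Proof.
have [r] := ubnP (\rank A); elim: r A => // r IHr A /ltnSE-leAr hA nuA.
have [rAA | ltAA] := eqVneq (\rank (A *m A)) (\rank A).
  have [A0 | uA] := endo_stable_rank hA rAA; first by exists 1%N; rewrite expr1.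
  by rewrite uA in nuA.
have [|||k Ak0] := IHr (A *m A).
- apply: leq_trans leAr; rewrite ltn_neqAle ltAA; exact: mxrankM_maxl.
- exact: (homM hA hA).
- by apply: contra nuA; rewrite unitmx_mul => /andP[].
by exists (2 * k)%N; rewrite exprM expr2; exact: Ak0.
Qed.

(** After dividing by A + B the two summands add up to 1; if the first is
    nilpotent, a geometric series inverts the second. *)
Lemma endo_local (A B : 'M[K]_n) : mxhom G V V A -> mxhom G V V B ->
  A + B \in unitmx -> A \in unitmx \/ B \in unitmx.
Proof.
move=> hA hB uAB; have [uA | nuA] := boolP (A \in unitmx); [by left | right].
have hC := homV uAB (homD hA hB).
have [||k] := endo_nilp_unit (A := invmx (A + B) *m A); first exact: homM hC hA.
  by rewrite unitmx_mul (negPf nuA) andbF.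
move=> Nk.
have defB : B = (A + B) *m (1%:M - invmx (A + B) *m A).
  by rewrite mulmxBr mulmx1 mulmxA mulmxV // mul1mx addrC addKr.
rewrite defB unitmx_mul uAB /=.
set N := _ *m A in Nk *.
have [] := @mulmx1_unit _ _ (1%:M - N) (\sum_(i < k) N ^+ i) => //.
by have /eqP := subrX1 N k; rewrite Nk sub0r eqr_oppLR -mulNr opprB => /eqP.
Qed.

Lemma endo_local_sum (I : finType) (P : pred I) (A : I -> 'M[K]_n) :
  (forall i, P i -> mxhom G V V (A i)) ->
  \sum_(i | P i) A i \in unitmx -> exists2 i, P i & A i \in unitmx.
Proof.
move=> hA uS.
suff: mxhom G V V (\sum_(i | P i) A i) /\
   (\sum_(i | P i) A i \in unitmx -> exists2 i, P i & A i \in unitmx).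
  by case=> _; apply.
elim/big_rec: _ => [|i B Pi [hB IH]].
  split; first exact: hom0.
  by rewrite (negPf endo0_nonunit).
split; first by apply: homD hB; apply: hA.
by case/(endo_local (hA i Pi) hB) => // uA; exists i.
Qed.

End Local.

(** The form in which the Krull-Schmidt decomposition is used: if the identity
    of M escapes an additive class of endomorphisms, so does the projection on
    some indecomposable summand. *)
Lemma exists_summand (M : representation K G)
    (Small : 'M[K]_(rdegree M) -> Prop) :
  Small 0 ->
  (forall A B, mxhom G M M A -> mxhom G M M B ->
     Small A -> Small B -> Small (A + B)) ->
  ~ Small 1%:M ->
  exists (V : representation K G) A B,
    [/\ indecomposable V, mxhom G V M A, mxhom G M V B, A *m B = 1%:M
      & ~ Small (B *m A)].
Proof.
have [r] := ubnP (rdegree M).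
elim: r M Small => // r IHr M Small /ltnSE-leMr S0 SD nS1.
have [[U [U' [isoM [nzU nzU']]]] | nodec] := pselect (exists U U',
    iso M (dadd_grepr U U') /\ rdegree U <> 0%N /\ rdegree U' <> 0%N);
      last first.
  exists M, 1%:M, 1%:M; rewrite mulmx1; split=> //; try exact: hom1.
  split=> [|U U' isoM].
    rewrite lt0n; apply/negP=> /eqP M0; apply: nS1.
    have /eqP -> // : (1%:M : 'M[K]_(rdegree M)) == 0.
    by rewrite -mxrank_eq0 mxrank1 M0.
  have [|nzU] := eqVneq (rdegree U) 0%N; [by left | right].
  apply: contrapT => nzU'; apply: nodec; exists U, U'; split=> //.
  by split=> //; apply/eqP.
have degM : rdegree M = (rdegree U + rdegree U')%N by case: isoM.
have step (W : representation K G) i q : (rdegree W < rdegree M)%N ->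
    mxhom G W M i -> mxhom G M W q -> i *m q = 1%:M -> ~ Small (q *m i) ->
  exists (V : representation K G) A B,
    [/\ indecomposable V, mxhom G V M A, mxhom G M V B, A *m B = 1%:M
      & ~ Small (B *m A)].
  move=> ltW hi hq iq nS.
  have [||||V [A [B [indV hA hB AB nS']]]] :=
    IHr W (fun X => Small (q *m X *m i)).
  - exact: leq_trans ltW leMr.
  - by rewrite mulmx0 mul0mx.
  - move=> X Y hX hY SX SY; rewrite mulmxDr mulmxDl; apply: SD => //;
      apply: homM hi; exact: homM hq _.
  - by rewrite mulmx1.
  exists V, (A *m i), (q *m B); split=> //.
  - exact: homM hA hi.
  - exact: homM hq hB.
  - by rewrite mulmxA -(mulmxA A) iq mulmx1.
  - by rewrite -mulmxA [B *m _]mulmxA mulmxA.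
have [i [q [j [t [[hi hq hj ht] [iq jt dec]]]]]] := iso_dadd_split isoM.
have [S1 | nS] := pselect (Small (q *m i)); last first.
  apply: step hi hq iq nS.
  by rewrite degM -[ltnLHS]addn0 ltn_add2l lt0n; apply/eqP.
apply: (step U' j t) => //.
  by rewrite degM -[ltnLHS]add0n ltn_add2r lt0n; apply/eqP.
move=> S2; apply: nS1; rewrite -dec; apply: SD => //.
  exact: homM hq hi.
exact: homM ht hj.
Qed.

End Homs.

(** * Sums over cosets *)

Section CosetSums.

Variables (gT : finGroupType) (M : nmodType).
Implicit Types R Q L G : {group gT}.

Definition coset_sum (R G : {set gT}) (phi : gT -> M) : M :=
  \sum_(C in rcosets R G) phi (repr C).

Definition coset_invariant (R G : {set gT}) (phi : gT -> M) : Prop :=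
  forall r g, r \in R -> g \in G -> phi (r * g)%g = phi g.

Lemma repr_rcosets R G C : R \subset G -> C \in rcosets R G ->
  repr C \in G /\ (R :* repr C)%g = C.
Proof.
move=> sRG /rcosetsP[x Gx ->]; rewrite rcoset_repr; split=> //.
have /rcosetP[r Rr ->] := mem_repr_rcoset R x.
by rewrite groupM // (fintype.subsetP sRG).
Qed.

(** The value at the canonical representative of a coset may be replaced by the
    value at any other element of it. *)
Lemma coset_sum_reindex R G phi (T : finType) (J : {set T}) (x : T -> gT)
    (S : {set {set gT}}) :
  coset_invariant R G phi ->
  (forall j, j \in J -> x j \in G) ->
  {in J &, injective (fun j => R :* x j)%g} ->
  [set (R :* x j)%g | j in J] = S ->
  \sum_(C in S) phi (repr C) = \sum_(j in J) phi (x j).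
Proof.
move=> inv_phi Gx injx <-; rewrite big_imset //=; apply: eq_bigr => j Jj.
have /rcosetP[r Rr ->] := mem_repr_rcoset R (x j).
by rewrite inv_phi ?Gx.
Qed.

Lemma coset_sum_act R G phi h : R \subset G -> h \in G ->
  coset_invariant R G phi ->
  coset_sum R G (fun g => phi (g * h)%g) = coset_sum R G phi.
Proof.
move=> sRG Gh inv_phi; symmetry.
apply: (coset_sum_reindex (x := fun C => repr C * h)%g _ inv_phi).
- by move=> C /(repr_rcosets sRG)[GC _]; rewrite groupM.
- move=> C D /(repr_rcosets sRG)[_ defC] /(repr_rcosets sRG)[_ defD] /=.
  by rewrite !rcosetM defC defD => /rcoset_inj.
apply/setP=> C; apply/imsetP/rcosetsP=> [[D]|[x Gx ->]].
  case/(repr_rcosets sRG) => GD _ ->.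
  by exists (repr D * h)%g; rewrite ?groupM.
exists (R :* (x * h^-1))%g.
  by apply/rcosetsP; exists (x * h^-1)%g; rewrite ?groupM ?groupV.
by rewrite rcosetM rcoset_repr -rcosetM mulgKV.
Qed.

Lemma coset_sum_trans R Q G phi : R \subset Q -> Q \subset G ->
  coset_invariant R G phi ->
  coset_sum R G phi =
    coset_sum Q G (fun d => coset_sum R Q (fun c => phi (c * d)%g)).
Proof.
move=> sRQ sQG inv_phi; rewrite /coset_sum pair_big_dep /=.
have sRG := fintype.subset_trans sRQ sQG.
rewrite (coset_sum_reindex (J := finset.setX (rcosets Q G) (rcosets R Q))
  (x := fun u => repr u.2 * repr u.1)%g _ inv_phi) //.
- by apply: eq_bigl => u; rewrite inE.
- case=> D C; rewrite inE /= => /andP[/(repr_rcosets sQG)[GD _]].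
  by case/(repr_rcosets sRQ)=> QC _; rewrite groupM // (fintype.subsetP sQG).
- case=> D C [D' C']; rewrite !inE /=.
  move=> /andP[/(repr_rcosets sQG)[GD defD] /(repr_rcosets sRQ)[QC defC]].
  move=> /andP[/(repr_rcosets sQG)[GD' defD'] /(repr_rcosets sRQ)[QC' defC']].
  move=> eqR.
  have eqD : D = D'.
    rewrite -defD -defD'; apply/rcoset_eqP; rewrite mem_rcoset.
    have: (repr C * repr D \in R :* (repr C' * repr D'))%g.
      by rewrite -eqR rcoset_refl.
    rewrite mem_rcoset => /(fintype.subsetP sRQ).
    by rewrite invMg !mulgA groupMr ?groupV // -mulgA groupMl.
  by move: eqR; rewrite eqD !rcosetM defC defC' => /rcoset_inj ->.
apply/setP=> C; apply/imsetP/rcosetsP=> [[[D B]]|[x Gx ->]].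
  rewrite inE /= => /andP[/(repr_rcosets sQG)[GD _]].
  case/(repr_rcosets sRQ)=> QB _ ->.
  by exists (repr B * repr D)%g; rewrite ?groupM // (fintype.subsetP sQG).
have /rcosetP[q Qq def_q] := mem_repr_rcoset Q x.
exists (Q :* x, R :* q^-1)%g.
  by rewrite inE /= !mem_rcosets (mulSGid sQG) (mulSGid sRQ) Gx groupV.
by rewrite /= rcosetM rcoset_repr def_q -rcosetM mulKg.
Qed.

(** Mackey's formula: the orbit of the coset Qg under right multiplication by L
    is parametrized by the cosets in L of the stabilizer of Qg, which is the
    intersection of L with the conjugate of Q by g.  The set S is an arbitrary
    L-stable set of cosets, so that those inside a subgroup can be set apart. *)
Lemma coset_sum_Mackey Q L G phi (S : {set {set gT}}) :
  Q \subset G -> L \subset G -> S \subset rcosets Q G ->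
  [acts L, on S | 'Rs] -> coset_invariant Q G phi ->
  exists (I : finType) (P : pred I) (g : I -> gT),
    (forall i, P i -> g i \in G /\ (Q :* g i)%g \in S) /\
    \sum_(C in S) phi (repr C) =
    \sum_(i | P i) coset_sum (Q :^ g i :&: L)%g L (fun l => phi (g i * l)%g).
Proof.
move=> sQG sLG sSG actS inv_phi.
have parS := orbit_partition actS.
exists {set {set gT}}, (mem (orbit 'Rs L @: S)), (fun O => repr (repr O)).
have inO O : O \in orbit 'Rs L @: S ->
    exists g, [/\ g \in G, (Q :* g)%g \in S, g = repr (repr O)
               & O = orbit 'Rs L (Q :* g)%g].
  case/imsetP=> C SC defO; have OC : C \in O by rewrite defO orbit_refl.
  have Or : repr O \in O := mem_repr _ OC.
  have Sr : repr O \in S.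
    have := acts_sub_orbit C actS; rewrite SC => /fintype.subsetP; apply.
    by rewrite -defO.
  have [Gg defr] := repr_rcosets sQG (fintype.subsetP sSG _ Sr).
  exists (repr (repr O)); split; rewrite ?defr //.
  by rewrite defO; apply/esym/orbit_eqP; rewrite -defO.
split=> [O /inO[g [Gg Sg <- _]] //|].
rewrite (set_partition_big _ parS) /=;
  apply: eq_bigr => O /inO[g [Gg Sg <- defO]].
rewrite (coset_sum_reindex (G := G) (J := (rcosets (Q :^ g :&: L) L)%g)
  (x := fun C => (g * repr C)%g) inv_phi) //.
- move=> C /(repr_rcosets (subsetIr _ _))[LC _].
  by rewrite groupM // (fintype.subsetP sLG).
- move=> C D /(repr_rcosets (subsetIr _ _))[LC defC].
  case/(repr_rcosets (subsetIr _ _)) => LD defD /= eqC.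
  rewrite -defC -defD; apply/rcoset_eqP; rewrite mem_rcoset inE.
  apply/andP; split; last by rewrite groupM ?groupV.
  have: (g * repr C \in Q :* (g * repr D))%g by rewrite -eqC rcoset_refl.
  by rewrite mem_rcoset mem_conjg conjgE invgK invMg !mulgA.
rewrite defO; apply/setP=> C; apply/imsetP/orbitP=> [[D]|[l Ll <-]].
  case/(repr_rcosets (subsetIr _ _))=> LD _ ->; exists (repr D) => //=.
  by rewrite rcosetE rcosetM.
exists ((Q :^ g :&: L) :* l)%g; first by rewrite mem_rcosets mulSGid ?subsetIr.
have /rcosetP[q] := mem_repr_rcoset (Q :^ g :&: L)%G l.
rewrite inE => /andP[Qq _] -> /=; rewrite rcosetE mulgA [RHS]rcosetM.
congr (_ :* _)%g; apply/esym/rcoset_eqP.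
by move: Qq; rewrite mem_rcoset mem_conjg conjgE invgK mulgA.
Qed.

End CosetSums.

(** * The relative trace *)

Section Trace.

Variables (gT : finGroupType) (K : fieldType).
Implicit Types R Q L G : {group gT}.

Definition conjm n m (U : gT -> 'M[K]_n) (V : gT -> 'M[K]_m)
    (A : 'M[K]_(n, m)) (g : gT) : 'M[K]_(n, m) :=
  U (g^-1)%g *m A *m V g.

Definition rel_trace (R G : {set gT}) n m (U : gT -> 'M[K]_n) (V : gT ->
  'M[K]_m)
    (A : 'M[K]_(n, m)) : 'M[K]_(n, m) :=
  coset_sum R G (conjm U V A).

Lemma trace_mull R L n m k (U : gT -> 'M_n) (V : gT -> 'M_m)
    (W : gT -> 'M_k) B A :
  R \subset L -> mxhom L U V B ->
  rel_trace R L U W (B *m A) = B *m rel_trace R L V W A.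
Proof.
move=> sRL hB; rewrite /rel_trace /coset_sum mulmx_sumr.
apply: eq_bigr => C /(repr_rcosets sRL)[LC _].
by rewrite /conjm !mulmxA hB ?groupV.
Qed.

Lemma trace_mulr R L n m k (U : gT -> 'M_n) (V : gT -> 'M_m)
    (W : gT -> 'M_k) B A :
  R \subset L -> mxhom L V W B ->
  rel_trace R L U W (A *m B) = rel_trace R L U V A *m B.
Proof.
move=> sRL hB; rewrite /rel_trace /coset_sum mulmx_suml.
apply: eq_bigr => C /(repr_rcosets sRL)[LC _].
by rewrite /conjm -!mulmxA hB.
Qed.

Lemma trace0 (R G : {set gT}) n m (U : gT -> 'M_n) (V : gT -> 'M_m) :
  rel_trace R G U V 0 = 0.
Proof. by apply: big1 => C _; rewrite /conjm mulmx0 mul0mx. Qed.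

Lemma traceD (R G : {set gT}) n m (U : gT -> 'M_n) (V : gT -> 'M_m) A B :
  rel_trace R G U V (A + B) = rel_trace R G U V A + rel_trace R G U V B.
Proof.
rewrite -big_split; apply: eq_bigr => C _ /=.
by rewrite /conjm mulmxDr mulmxDl.
Qed.

Lemma traceZ (R G : {set gT}) n m (U : gT -> 'M_n) (V : gT -> 'M_m) c A :
  rel_trace R G U V (c *: A) = c *: rel_trace R G U V A.
Proof.
rewrite scaler_sumr; apply: eq_bigr => C _ /=.
by rewrite /conjm -scalemxAr -scalemxAl.
Qed.

Lemma trace_sum (R G : {set gT}) n m (U : gT -> 'M_n) (V : gT -> 'M_m)
    (I : finType) (P : pred I) (A : I -> 'M_(n, m)) :
  rel_trace R G U V (\sum_(i | P i) A i) =
    \sum_(i | P i) rel_trace R G U V (A i).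
Proof. exact: (big_morph _ (traceD R G U V) (trace0 R G U V)). Qed.

Variable G : {group gT}.

Lemma trace_id L n m (U : mx_representation K G n)
  (V : mx_representation K G m) A :
  L \subset G -> rel_trace L L U V A = A.
Proof.
move=> sLG; rewrite /rel_trace /coset_sum rcosets_id big_set1 /conjm repr_group.
by rewrite invg1 !repr_mx1 mulmx1 mul1mx.
Qed.

Section Representations.

Variables (n m : nat) (U : mx_representation K G n).
Variable (V : mx_representation K G m).

Lemma conjmM A g h : g \in G -> h \in G ->
  conjm U V A (g * h) = conjm U V (conjm U V A g) h.
Proof.
by move=> Gg Gh; rewrite /conjm invMg !repr_mxM ?groupV // !mulmxA.
Qed.

Lemma conjm_invariant R A : R \subset G -> mxhom R U V A ->
  coset_invariant R G (conjm U V A).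
Proof.
move=> sRG hA r g Rr Gg; have Gr := fintype.subsetP sRG r Rr.
by rewrite conjmM // {2}/conjm hA ?groupV // -mulmxA -repr_mxM ?groupV // mulVg
  repr_mx1 mulmx1.
Qed.

Lemma hom_conjm R A g : R \subset G -> g \in G -> mxhom R U V A ->
  mxhom (R :^ g)%g U V (conjm U V A g).
Proof.
move=> sRG Gg hA h; rewrite mem_conjg => Rr.
set r := (h ^ g^-1)%g in Rr; have Gr := fintype.subsetP sRG r Rr.
have eq_gh : (g * h = r * g)%g by rewrite /r conjgE invgK !mulgA mulgKV.
have Gh : h \in G by rewrite -(groupMl _ Gg) eq_gh groupM.
have eq_hg : (h * g^-1 = g^-1 * r)%g
  by rewrite /r conjgE invgK !mulgA mulVg mul1g.
rewrite /conjm -[RHS]mulmxA -(repr_mxM V) // eq_gh repr_mxM // !mulmxA.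
rewrite -repr_mxM ?groupV // eq_hg repr_mxM ?groupV //.
by congr (_ *m _); rewrite -!mulmxA hA.
Qed.

Lemma hom_trace R L A : R \subset L -> L \subset G -> mxhom R U V A ->
  mxhom L U V (rel_trace R L U V A).
Proof.
move=> sRL sLG hA h Lh; have sRG := fintype.subset_trans sRL sLG.
have Gh := fintype.subsetP sLG h Lh.
have inv_L : coset_invariant R L (conjm U V A).
  by move=> r g Rr Lg; apply: (conjm_invariant sRG hA Rr
    (fintype.subsetP sLG g Lg)).
rewrite {1}/rel_trace -(coset_sum_act sRL Lh inv_L) /coset_sum mulmx_sumr
  mulmx_suml.
apply: eq_bigr => C /(repr_rcosets sRL)[/(fintype.subsetP sLG)GC _].
rewrite conjmM // {1}/conjm !mulmxA -repr_mxM ?groupV // mulgV repr_mx1.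
by rewrite mul1mx.
Qed.

Lemma trace_trans R L A : R \subset L -> L \subset G -> mxhom R U V A ->
  rel_trace R G U V A = rel_trace L G U V (rel_trace R L U V A).
Proof.
move=> sRL sLG hA; rewrite /rel_trace.
have sRG := fintype.subset_trans sRL sLG.
rewrite (coset_sum_trans sRL sLG (conjm_invariant sRG hA)).
apply: eq_bigr => D /(repr_rcosets sLG)[GD _].
rewrite [RHS]/conjm /coset_sum mulmx_sumr mulmx_suml; apply: eq_bigr => C.
by case/(repr_rcosets sRL)=> /(fintype.subsetP sLG) GC _; rewrite conjmM.
Qed.

(** The conjugate of A by g commutes with the conjugate of Q by g
    ([hom_conjm]), so its relative trace to L makes sense. *)
Lemma trace_Mackey Q L (S : {set {set gT}}) A :
  Q \subset G -> L \subset G -> S \subset rcosets Q G ->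
  [acts L, on S | 'Rs] -> mxhom Q U V A ->
  exists (I : finType) (P : pred I) (g : I -> gT),
    (forall i, P i -> g i \in G /\ (Q :* g i)%g \in S) /\
    \sum_(C in S) conjm U V A (repr C) =
    \sum_(i | P i) rel_trace (Q :^ g i :&: L)%g L U V (conjm U V A (g i)).
Proof.
move=> sQG sLG sSG actS hA.
have [I [P [g [Gg ->]]]] :=
  coset_sum_Mackey sQG sLG sSG actS (conjm_invariant sQG hA).
exists I, P, g; split=> //; apply: eq_bigr => i /Gg[Gi _].
apply: eq_bigr => C /(repr_rcosets (subsetIr _ _))[/(fintype.subsetP sLG)GC _].
by rewrite conjmM.
Qed.

End Representations.

End Trace.

(** * Higman's criterion *)

Section Higman.

Variables (gT : finGroupType) (K : fieldType) (R G : {group gT}).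
Variables (sRG : R \subset G).

Lemma traceE n m (U : gT -> 'M[K]_n) (V : gT -> 'M[K]_m) A :
  rel_trace R G U V A = \sum_(i < #|rcosets R G|) conjm U V A (coset_rep i).
Proof. exact: big_enum_val. Qed.

(** Frobenius reciprocity: G-maps from V to Ind S and back amount to R-maps a
    and b between V and S (their components at the trivial coset), and the
    composite of the G-maps is the relative trace of the composite a b. *)
Lemma divides_IndP (V : representation K G) (S : representation K R) :
  divides V (Ind S sRG) <->
  exists a b, [/\ mxhom R V S a, mxhom R S V b & rel_trace R G V V
    (a *m b) = 1%:M].
Proof.
split=> [/dividesP[A [B [hA hB AB]]] | [a [b [ha hb tr1]]]]; last first.
  apply/dividesP.
  exists (\mxrow_j (V (coset_rep j)^-1%g *m a) : 'M_(_,
    \sum_(j < #|rcosets R G|) rdegree S)).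
  exists (\mxcol_i (b *m V
    (coset_rep i)) : 'M_(\sum_(i < #|rcosets R G|) rdegree S, _)).
  split=> [g Gg|g Gg|].
  - rewrite /= mul_mxrow mul_mxrow_mxblock; apply: eq_mxrow => j.
    have [i Rij] := coset_rep_ex R (groupM (coset_rep_in sRG j) (groupVr Gg)).
    have Rx : (coset_rep i * g * (coset_rep j)^-1 \in R)%g.
      by rewrite -groupV !invMg invgK mulgA.
    rewrite (bigD1 i) //= Rx big1 ?addr0 => [|k neq_ki].
      rewrite -mulmxA -ha // !mulmxA -!repr_mxM ?groupM ?groupV ?(coset_rep_in
        sRG) //.
      by rewrite !mulgA mulVg mul1g.
    case: ifP => [Rk|]; last by rewrite mulmx0.
    case/eqP: neq_ki; apply/eqP; rewrite -coset_rep_eq.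
    by have:= groupM Rk (groupVr Rx); rewrite !invMg !invgK !mulgA mulgKV mulgK.
  - rewrite /= mxcol_mul mul_mxblock_mxrow; apply: eq_mxcol => i.
    have [j Rx] := coset_rep_ex R (groupM (coset_rep_in sRG i) Gg).
    rewrite (bigD1 j) //= Rx big1 ?addr0 => [|k neq_kj].
      rewrite mulmxA hb // -!mulmxA -!repr_mxM ?groupM ?groupV ?(coset_rep_in
        sRG) //.
      by rewrite mulgKV.
    case: ifP => [Rk|]; last by rewrite mul0mx.
    case/eqP: neq_kj; apply/eqP; rewrite eq_sym -coset_rep_eq.
    by have:= groupM (groupVr Rx) Rk;
      rewrite !invMg !invgK !mulgA mulgKV mulgKV.
  - rewrite mul_mxrow_mxcol -tr1 traceE; apply: eq_bigr => i _.
    by rewrite /conjm !mulmxA.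
pose a j : 'M_(_, rdegree S) := submxrow A j.
pose b i : 'M_(rdegree S, _) := submxcol B i.
have defA : A = \mxrow_j a j by rewrite submxrowK.
have defB : B = \mxcol_i b i by rewrite submxcolK.
have RG : (R : {set gT}) \in rcosets R G.
  by apply/rcosetsP; exists 1%g; rewrite ?mulg1.
pose i0 := enum_rank_in RG R.
have t0 : coset_rep i0 = 1%g by rewrite /coset_rep enum_rankK_in // repr_group.
(* The intertwining relations, read off in the block column (for A) and the
   block row (for B) of the trivial coset, express all blocks by those at i0. *)
have ea k r : r \in R -> V ((coset_rep k)^-1 * r)%g *m a i0 = a k *m S r.
  move=> Rr; have Gk := coset_rep_in sRG k; have Gr := fintype.subsetP sRG r Rr.
  have := hA ((coset_rep k)^-1 * r)%g; rewrite groupM ?groupV // => /(_ isT).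
  rewrite defA /= mul_mxrow mul_mxrow_mxblock => /eq_mxrowP/(_ i0) ->.
  rewrite (bigD1 k) //= t0 invg1 mulg1 mulKVg Rr big1 ?addr0 // => i neq_ik.
  case: ifP => [Ri|]; last by rewrite mulmx0.
  case/eqP: neq_ik; apply/eqP; rewrite -coset_rep_eq.
  by have:= groupM Ri (groupVr Rr); rewrite mulg1 mulgA mulgK.
have eb k r : r \in R -> S r *m b k = b i0 *m V (r * coset_rep k)%g.
  move=> Rr; have Gk := coset_rep_in sRG k; have Gr := fintype.subsetP sRG r Rr.
  have := hB (r * coset_rep k)%g; rewrite groupM // => /(_ isT).
  rewrite defB /= mxcol_mul mul_mxblock_mxrow => /eq_mxcolP/(_ i0) <-.
  rewrite (bigD1 k) //= t0 mul1g mulgK Rr big1 ?addr0 // => i neq_ik.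
  case: ifP => [Ri|]; last by rewrite mul0mx.
  case/eqP: neq_ik; apply/eqP; rewrite eq_sym -coset_rep_eq.
  by have:= groupM (groupVr Rr) Ri; rewrite !mulgA mulVg mul1g.
exists (a i0), (b i0); split=> [r Rr|r Rr|].
- by have := ea i0 r Rr; rewrite t0 invg1 mul1g.
- by have := eb i0 r Rr; rewrite t0 mulg1.
rewrite traceE -AB defA defB mul_mxrow_mxcol; apply: eq_bigr => k _.
have := ea k 1%g (group1 R); have := eb k 1%g (group1 R).
rewrite mul1g mulg1 repr_mx1 mul1mx mulmx1 => -> <-.
by rewrite /conjm !mulmxA.
Qed.

(** An endomorphism A of relative trace 1 splits V off the module induced from
    its own restriction. *)
Lemma rel_projectiveP (V : representation K G) :
  rel_projective sRG V <->
  exists2 A, mxhom R V V A & rel_trace R G V V A = 1%:M.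
Proof.
split=> [[S /divides_IndP[a [b [ha hb tr1]]]] | [A hA tr1]].
  by exists (a *m b) => //; exact: homM ha hb.
exists (Res sRG V); apply/divides_IndP; exists A, 1%:M.
by split; rewrite ?mulmx1 //; apply: hom1.
Qed.

End Higman.

(** * Relative projectivity of simple and indecomposable modules *)

Section Projectivity.

Variables (gT : finGroupType) (K : fieldType) (G : {group gT}).
Implicit Types (R Q : {group gT}) (U V X : representation K G).

Lemma simple_end_unit V A : simple V -> mxhom G V V A -> A != 0 -> A \in unitmx.
Proof.
move=> simV hA; apply: mx_Schur simV _ _.
by apply/centgmxP=> g Gg; rewrite hA.
Qed.

Lemma unit_trace_rel_projective R (sRG : R \subset G) V A :
  mxhom R V V A -> rel_trace R G V V A \in unitmx -> rel_projective sRG V.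
Proof.
move=> hA uT; apply/rel_projectiveP.
have hT := homV uT (hom_trace sRG (fintype.subxx G) hA).
exists (A *m invmx (rel_trace R G V V A));
  first exact: homM hA (hom_sub sRG hT).
by rewrite (trace_mulr _ _ sRG hT) mulmxV.
Qed.

(** Relative traces are endomorphisms, and nonzero ones are invertible by
    Schur's lemma. *)
Lemma simple_rel_projective R (sRG : R \subset G) V A : simple V ->
  mxhom R V V A -> rel_trace R G V V A != 0 -> rel_projective sRG V.
Proof.
move=> simV hA nzT; apply: unit_trace_rel_projective (hA) _.
exact: simple_end_unit simV (hom_trace sRG (fintype.subxx G) hA) nzT.
Qed.

Lemma trace_split R U V (i : 'M_(rdegree U, rdegree V)) A
    (q : 'M_(rdegree V, rdegree U)) : R \subset G ->
  mxhom G U V i -> mxhom G V U q ->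
  rel_trace R G U U (i *m A *m q) = i *m rel_trace R G V V A *m q.
Proof.
by move=> sRG hi hq; rewrite (trace_mulr _ _ sRG hq) (trace_mull _ _ sRG hi).
Qed.

Lemma divides_rel_projective R (sRG : R \subset G) U V :
  divides U V -> rel_projective sRG V -> rel_projective sRG U.
Proof.
move=> /dividesP[i [q [hi hq iq]]] /rel_projectiveP[A hA trA].
apply/rel_projectiveP; exists (i *m A *m q).
  exact: homM (homM (hom_sub sRG hi) hA) (hom_sub sRG hq).
by rewrite trace_split // trA mulmx1.
Qed.

Lemma divides_unit U V (i : 'M_(rdegree U, rdegree V)) q :
  mxhom G U V i -> mxhom G V U q -> i *m q \in unitmx -> divides U V.
Proof.
move=> hi hq u; apply/dividesP; exists i, (q *m invmx (i *m q)).
split=> //; last by rewrite mulmxA mulmxV.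
exact: homM hq (homV u (homM hi hq)).
Qed.

(** The projection of V on its nonzero summand U is a nonzero idempotent of a
    local ring, hence the identity. *)
Lemma divides_indec U V : (0 < rdegree U)%N -> indecomposable V ->
  divides U V -> divides V U.
Proof.
move=> U_gt0 indV /dividesP[i [q [hi hq iq]]].
have hqi := homM hq hi.
have qiqi : q *m i *m (q *m i) = q *m i by rewrite mulmxA -(mulmxA q) iq mulmx1.
have [|qi0|u] := endo_stable_rank indV hqi; first by rewrite qiqi.
  have: i *m (q *m i) *m q = 1%:M by rewrite mulmxA iq mul1mx iq.
  rewrite qi0 mulmx0 mul0mx => /(congr1 mxrank).
  by rewrite mxrank0 mxrank1 => U0; rewrite -U0 in U_gt0.
apply: divides_unit hq hi u.
Qed.

End Projectivity.

(** * Sources *)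

Section Sources.

Variables (gT : finGroupType) (K : fieldType) (G Q : {group gT}).
Variables (sQG : Q \subset G) (X : representation K G).
Hypotheses (simX : simple X) (vX : vertex Q X).

Lemma vertex_rel_projective : rel_projective sQG X.
Proof. by case: vX => sQG' []; rewrite (bool_irrelevance sQG' sQG). Qed.

(** As 1 = Tr_Q^G(x), the additive map that sends A to Tr_Q^G(x A) is nonzero at
    the identity of the restriction of X to Q, hence at the projection on some
    indecomposable summand. *)
Lemma exists_source_summand :
  exists (S : representation K Q) i q x,
    [/\ indecomposable S, mxhom Q S X i, mxhom Q X S q, i *m q = 1%:M
      & mxhom Q X X x /\ rel_trace Q G X X (x *m q *m i) != 0].
Proof.
have /rel_projectiveP[x hx trx] := vertex_rel_projective.
have [|A B hA hB|/eqP|S [i [q [indS hi hq iq nz]]]] :=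
    @exists_summand _ _ _ (Res sQG X) (fun A => rel_trace Q G X X (x *m A) = 0).
- by rewrite mulmx0 trace0.
- by rewrite mulmxDr traceD => -> ->; rewrite addr0.
- rewrite mulmx1 trx -mxrank_eq0 mxrank1.
  by have [+ _] := (mx_irrP X).1 simX; rewrite lt0n => /negPf->.
by exists S, i, q, x; split=> //; split=> //; rewrite -mulmxA; apply/eqP.
Qed.

Lemma conj_hom (S T : representation K Q) g (nQg : g \in 'N(Q)%g)
    (A : 'M_(rdegree S, rdegree T)) :
  mxhom Q S (conj_mod nQg T) A <->
  forall q, q \in Q -> S (q ^ g)%g *m A = A *m T q.
Proof.
split=> hA q Qq; last by rewrite -{1}(conjgKV g q) hA ?memJ_norm ?groupV.
by rewrite hA ?memJ_norm //= /conj_mx conjgK.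
Qed.

Lemma hom_conj (S T : representation K Q) g (nQg : g \in 'N(Q)%g)
    (B : 'M_(rdegree T, rdegree S)) :
  mxhom Q (conj_mod nQg T) S B <->
  forall q, q \in Q -> T q *m B = B *m S (q ^ g)%g.
Proof.
split=> hB q Qq; last by rewrite -{2}(conjgKV g q) -hB ?memJ_norm ?groupV.
by rewrite -hB ?memJ_norm //= /conj_mx conjgK.
Qed.

(** Mackey's formula writes the identity of S as a sum of traces
    i Tr_R(conjugate of a b) q with R = Q^g /\ Q; one of them is a unit since
    End_Q(S) is local.  If R were smaller than Q, substituting that unit in the
    nonzero trace Tr_Q^G(x q i) would make X relatively R-projective, against
    the minimality of Q.  So g normalizes Q, the trace from R = Q to Q is
    trivial, and the unit is a composite of maps S -> T^g -> S. *)
Lemma source_summand_conj (S : representation K Q) i q x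
    (T : representation K Q) :
  indecomposable S -> mxhom Q S X i -> mxhom Q X S q -> i *m q = 1%:M ->
  mxhom Q X X x -> rel_trace Q G X X (x *m q *m i) != 0 ->
  divides X (Ind T sQG) ->
  exists (g : gT) (nQg : g \in 'N(Q)%g), g \in G /\ divides S (conj_mod nQg T).
Proof.
move=> indS hi hq iq hx nz /divides_IndP[a [b [ha hb trab]]].
have actQ : [acts Q, on rcosets Q G | 'Rs].
  exact: fintype.subset_trans sQG (actsRs_rcosets _ _).
have hab := homM ha hb.
have [I [P [g [Gg]]]] := trace_Mackey sQG sQG (fintype.subxx _) actQ hab.
rewrite -[LHS]/(rel_trace Q G X X (a *m b)) trab => eq1.
pose R j := (Q :^ g j :&: Q)%G.
pose y j := i *m conjm X X (a *m b) (g j) *m q.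
have hy j : P j -> mxhom (R j) S S (y j).
  case/Gg=> Gj _; have sR : R j \subset Q := subsetIr _ _.
  apply: homM (homM (hom_sub sR hi) _) (hom_sub sR hq).
  by apply: hom_sub (subsetIl _ _) _; apply: hom_conjm hab.
have : i *m q \in unitmx by rewrite iq unitmx1.
rewrite -[i in i *m q]mulmx1 eq1 mulmx_sumr mulmx_suml.
rewrite (eq_bigr (fun j => rel_trace (R j) Q S S (y j))) => [|j Pj]; last first.
  rewrite /y (trace_mulr _ _ (subsetIr _ _) hq).
  by rewrite (trace_mull _ _ (subsetIr _ _) hi).
case/(endo_local_sum indS) => [j Pj|j Pj uj].
  by apply: hom_trace (hy j Pj); rewrite ?subsetIr.
have [Gj _] := Gg j Pj.
have sRQ : R j \subset Q := subsetIr _ _.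
have hu := homV uj (hom_trace sRQ (fintype.subxx Q) (hy j Pj)).
set u := rel_trace _ _ _ _ _ in uj hu.
have defR : R j = Q.
  case: vX => sQG' [_ minQ].
  have sRG : R j \subset G := fintype.subset_trans sRQ sQG.
  apply: (minQ (R j) sRG sRQ); pose z := y j *m invmx u.
  have hz : mxhom (R j) S S z by apply: homM (hy j Pj) (hom_sub sRQ hu).
  have hzX : mxhom (R j) X X (x *m q *m z *m i).
    apply: homM (hom_sub sRQ hi); apply: homM hz.
    by apply: hom_sub sRQ _; apply: homM hx hq.
  apply: (simple_rel_projective _ simX hzX).
  rewrite (trace_trans sRQ sQG hzX) (trace_mulr _ _ sRQ hi).
  rewrite (trace_mull _ _ sRQ (homM hx hq)) (trace_mulr _ _ sRQ hu).
  by rewrite mulmxV // mulmx1.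
have nQg : g j \in 'N(Q)%g.
  have sQ : Q \subset (Q :^ g j)%g by rewrite -{1}defR subsetIl.
  have eqQ : (Q :^ g j)%g = Q by apply/esym/eqP;
    rewrite eqEcard sQ cardJg leqnn.
  by rewrite inE eqQ.
exists (g j), nQg; split=> //.
have def_u : u = y j by rewrite /u defR (trace_id _ _ _ (fintype.subxx Q)).
apply: (@divides_unit _ _ Q S (conj_mod nQg T)
  (i *m X (g j)^-1%g *m a) (b *m X (g j) *m q)).
- apply/conj_hom=> r Qr; have Gr := fintype.subsetP sQG r Qr.
  have Qrg : (r ^ g j)%g \in Q by rewrite memJ_norm.
  rewrite -(mulmxA _ a) -ha // !mulmxA hi // -!mulmxA; congr (i *m _).
  have Grg := fintype.subsetP sQG _ Qrg.
  by rewrite !mulmxA -!repr_mxM ?groupV // conjgE !mulgA mulgK.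
- apply/hom_conj=> r Qr; have Gr := fintype.subsetP sQG r Qr.
  have Qrg : (r ^ g j)%g \in Q by rewrite memJ_norm.
  have Grg := fintype.subsetP sQG _ Qrg.
  rewrite -(mulmxA _ q) -hq // !mulmxA hb //; congr (_ *m _).
  by rewrite -!mulmxA -!repr_mxM // conjgE mulgA mulgV mul1g.
- by have := uj; rewrite def_u /y /conjm !mulmxA.
Qed.

(** Z is a summand of S^g and of T^k.  As S is indecomposable, S is in turn a
    summand of the conjugate of Z by the inverse of g, hence h = g k^-1. *)
Lemma sources_conj (S T : representation K Q) : indecomposable S ->
  divides X (Ind S sQG) -> divides X (Ind T sQG) ->
  exists (h : gT) (nQh : h \in 'N(Q)%g),
    h \in 'N_G(Q)%g /\ divides (conj_mod nQh S) T.
Proof.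
move=> indS XS XT.
have [Z [i [q [x [indZ hi hq iq [hx nz]]]]]] := exists_source_summand.
have [g [nQg [Gg ZS]]] := source_summand_conj indZ hi hq iq hx nz XS.
have [k [nQk [Gk ZT]]] := source_summand_conj indZ hi hq iq hx nz XT.
have nQg' : g^-1%g \in 'N(Q)%g by rewrite groupV.
have SZ : divides S (conj_mod nQg' Z).
  apply: divides_indec indS _; first by case: indZ.
  apply/dividesP; have /dividesP[A [B [hA hB AB]]] := ZS.
  exists A, B; split=> //.
  - by apply: (@hom_conj S Z _ nQg' A).2 => r Qr; exact: hA.
  - by apply: (@conj_hom S Z _ nQg' B).2 => r Qr; exact: hB.
have nQh : (g * k^-1)%g \in 'N(Q)%g by rewrite groupM // groupV.
exists (g * k^-1)%g, nQh; split.
  by rewrite inE nQh groupM ?groupV.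
have /dividesP[A [B [/conj_hom hA /hom_conj hB AB]]] := SZ.
have /dividesP[C [D [/conj_hom hC /hom_conj hD CD]]] := ZT.
apply/dividesP; exists (A *m C), (D *m B); split.
- apply: (@hom_conj T S _ nQh (A *m C)).2 => r Qr;
    have Qrg : (r ^ g)%g \in Q by rewrite memJ_norm.
  have := hA _ Qrg; rewrite conjgK => eA.
  have := hC (r ^ (g * k^-1))%g; rewrite memJ_norm // => /(_ Qr).
  by rewrite -conjgM mulgKV => eC; rewrite mulmxA eA -mulmxA eC mulmxA.
- apply: (@conj_hom T S _ nQh (D *m B)).2 => r Qr;
    have Qrg : (r ^ g)%g \in Q by rewrite memJ_norm.
  have := hB _ Qrg; rewrite conjgK => eB.
  have := hD (r ^ (g * k^-1))%g; rewrite memJ_norm // => /(_ Qr).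
  by rewrite -conjgM mulgKV => eD; rewrite mulmxA eD -mulmxA eB mulmxA.
- by rewrite mulmxA -(mulmxA A) CD mulmx1.
Qed.

End Sources.

(** * Extension of scalars *)

Section BaseChange.

Variables (gT : finGroupType) (K E : fieldType) (f : {rmorphism K -> E}).
Local Notation "A ^f" := (map_mx f A) : ring_scope.
Implicit Types (L R : {set gT}).

Lemma hom_map L (G H : {group gT}) (U : representation K G)
    (V : representation K H) (A : 'M_(rdegree U, rdegree V)) :
  mxhom L U V A -> mxhom L (extend f U) (extend f V) A^f.
Proof. by move=> hA g Lg; rewrite /= -!map_mxM hA. Qed.

Lemma map_trace L R (G H : {group gT}) (U : representation K G)
    (V : representation K H) (A : 'M_(rdegree U, rdegree V)) :
  (rel_trace L R U V A)^f = rel_trace L R (extend f U) (extend f V) A^f.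
Proof.
rewrite /rel_trace /coset_sum map_mx_sum; apply: eq_bigr => C _.
by rewrite /conjm !map_mxM.
Qed.

Lemma divides_extend (G : {group gT}) (U V : representation K G) :
  divides U V -> divides (extend f U) (extend f V).
Proof.
move=> /dividesP[A [B [hA hB AB]]]; apply/dividesP; exists A^f, B^f.
by split; [apply: hom_map | apply: hom_map | rewrite -map_mxM AB map_mx1].
Qed.

Lemma iso_extend (G : {group gT}) (U V : representation K G) :
  iso U V -> iso (extend f U) (extend f V).
Proof. exact: mx_rsim_map. Qed.

Lemma simple_of_extend (G : {group gT}) (V : representation K G) :
  simple (extend f V) -> simple V.
Proof. exact: mx_irr_map. Qed.

Lemma rel_projective_extend (G R : {group gT}) (sRG : R \subset G)
    (V : representation K G) :
  rel_projective sRG V -> rel_projective sRG (extend f V).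
Proof.
move=> /rel_projectiveP[A hA trA]; apply/rel_projectiveP; exists A^f.
  exact: hom_map.
by rewrite -map_trace trA map_mx1.
Qed.

Lemma extend_Ind (G R : {group gT}) (sRG : R \subset G) (V : representation K G)
    (S : representation K R) :
  divides V (Ind S sRG) -> divides (extend f V) (Ind (extend f S) sRG).
Proof.
move=> /divides_IndP[a [b [ha hb trab]]]; apply/divides_IndP.
exists a^f, b^f; split; [exact: hom_map | exact: hom_map |].
by rewrite -map_mxM -map_trace trab map_mx1.
Qed.

(** Hom is the solution space of a linear system with coefficients in K: a basis
    over K of the solutions in K spans the solutions in E. *)
Lemma hom_base_change (R G H : {group gT}) (U : representation K G)
    (V : representation K H) (A : 'M[E]_(rdegree U, rdegree V)) :
  mxhom R (extend f U) (extend f V) A ->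
  exists N (w : 'I_N -> E) (B : 'I_N -> 'M[K]_(rdegree U, rdegree V)),
    (forall k, mxhom R U V (B k)) /\ A = \sum_k w k *: (B k)^f.
Proof.
move=> hA.
pose D g := lin_mulmx (U g) - lin_mulmxr (V g) : 'M[K]_(rdegree U * rdegree V).
pose H0 := (\bigcap_(g in R) kermx (D g))%MS.
exists _, (fun k => (mxvec A *m pinvmx H0^f) 0 k), (fun k => vec_mx (row k H0)).
split=> [k g Rg|].
  have : (row k H0 <= kermx (D g))%MS.
    by apply: submx_trans (row_sub _ _) _; apply: (bigcapmx_inf g).
  move/sub_kermxP; rewrite mulmxBr => /eqP;
    rewrite subr_eq0 -{1 2}[row k H0]vec_mxK.
  by rewrite !mul_vec_lin /= => /eqP/(can_inj mxvecK).
have DA g : g \in R -> mxvec A *m (D g)^f = 0.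
  move=> Rg; rewrite map_mxB.
  rewrite (map_lin_mx (gf := mulmx (U g)^f)) => [|B]; last by rewrite map_mxM.
  rewrite (map_lin_mx (gf := mulmxr (V g)^f)) => [|B];
    last by rewrite /= map_mxM.
  by rewrite mulmxBr !mul_vec_lin /= (hA g Rg) subrr.
have sA : (mxvec A <= H0^f)%MS.
  rewrite /H0; elim/big_rec: _ => [|g M Rg sAM];
    first by rewrite map_mx1 submx1.
  by rewrite map_capmx sub_capmx sAM map_kermx sub_kermx DA ?eqxx.
apply: (can_inj mxvecK); rewrite linear_sum /= -{1}(mulmxKpV sA).
rewrite mulmx_sum_row; apply: eq_bigr => k _.
by rewrite linearZ /= -map_row map_vec_mx vec_mxK.
Qed.

(** Let q i be the projection of the extension of W on V.  If A has trace 1 on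
    V, then q A i has trace q i, which is nonzero.  Expanding q A i along
    R-endomorphisms defined over K yields one of nonzero trace on W, which
    suffices since W is simple. *)
Lemma rel_projective_simple_extend (G R : {group gT}) (sRG : R \subset G)
    (W : representation K G) (V : representation E G) :
  simple W -> (0 < rdegree V)%N -> divides V (extend f W) ->
  rel_projective sRG V -> rel_projective sRG W.
Proof.
move=> simW V_gt0 /dividesP[i [q [hi hq iq]]] /rel_projectiveP[A hA trA].
have hqAi := homM (homM (hom_sub sRG hq) hA) (hom_sub sRG hi).
have [N [w [B [hB eqB]]]] := hom_base_change hqAi.
have [[k nzk] | allz] := pselect (exists k, rel_trace R G W W (B k) != 0).
  exact: simple_rel_projective simW (hB k) nzk.
have: rel_trace R G (extend f W) (extend f W) (q *m A *m i) = 0.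
  rewrite eqB trace_sum big1 // => k _; rewrite traceZ -map_trace.
  have [-> | nz] := eqVneq (rel_trace R G W W (B k)) 0;
    first by rewrite map_mx0 scaler0.
  by case: allz; exists k.
rewrite trace_split // trA mulmx1 => qi0.
have: i *m (q *m i) *m q = 1%:M by rewrite mulmxA iq mul1mx iq.
rewrite qi0 mulmx0 mul0mx => /(congr1 mxrank).
by rewrite mxrank0 mxrank1 => V0; rewrite -V0 in V_gt0.
Qed.

Lemma hom_descent (G : {group gT}) (U V : representation K G) A :
  mxhom G (extend f U) (extend f V) A -> A != 0 ->
  exists2 B, mxhom G U V B & B != 0.
Proof.
move=> /hom_base_change[N [w [B [hB ->]]]] nz.
have [[k nzk] | allz] := pselect (exists k, B k != 0); first by exists (B k).
case/eqP: nz; apply: big1 => k _.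
have [-> | nzk] := eqVneq (B k) 0; first by rewrite map_mx0 scaler0.
by case: allz; exists k.
Qed.

End BaseChange.

(** * Green correspondence *)

Section Green.

Variables (gT : finGroupType).

(** A unit Tr_R^H(A) makes U relatively R-projective.  Combined with
    1 = Tr_Q^H(B), Mackey's formula makes U projective relative to the
    intersections of R with the conjugates of Q, which all equal R /\ Q because
    Q is normal; minimality of Q then gives R /\ Q = Q. *)
Lemma normal_vertex_trace (K : fieldType) (H Q R : {group gT})
    (U : representation K H) (A : 'M_(rdegree U)) :
  (Q <| H)%g -> indecomposable U -> vertex Q U -> R \subset H ->
  mxhom R U U A -> rel_trace R H U U A \in unitmx -> Q \subset R.
Proof.
move=> /andP[sQH nQH] indU [sQH' [/rel_projectiveP[B hB trB] minQ]] sRH hA uA.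
have hT := homV uA (hom_trace sRH (fintype.subxx H) hA).
have actR : [acts R, on rcosets Q H | 'Rs].
  exact: fintype.subset_trans sRH (actsRs_rcosets _ _).
have [I [P [g [Hg]]]] := trace_Mackey sQH sRH (fintype.subxx _) actR hB.
rewrite -[LHS]/(rel_trace Q H U U B) trB => eq1.
have sIR : (Q :&: R)%G \subset R := subsetIr _ _.
have hA' := homM hA (hom_sub sRH hT).
have hc j : P j -> mxhom (Q :&: R)%G U U (conjm U U B (g j)).
  move=> Pj; have [Hj _] := Hg j Pj.
  apply: hom_sub (subsetIl _ _) _; rewrite -{1}(normsP nQH _ Hj).
  exact: hom_conjm hB.
have : (Q :&: R)%G = Q.
  apply: (minQ _ (fintype.subset_trans sIR sRH) (subsetIl _ _)).
  apply/rel_projectiveP.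
  exists (A *m invmx (rel_trace R H U U A) *m \sum_(j | P j) conjm U U B (g j)).
    by apply: homM (hom_sub sIR hA') _; apply: hom_sum.
  rewrite (trace_trans sIR sRH); last first.
    by apply: homM (hom_sub sIR hA') _; apply: hom_sum.
  rewrite (trace_mull _ _ sIR hA') trace_sum.
  rewrite [X in _ *m X](_ : _ = 1%:M); last first.
    rewrite eq1; apply: eq_bigr => j Pj; have [Hj _] := Hg j Pj.
    by rewrite /= (normsP nQH).
  by rewrite mulmx1 (trace_mulr _ _ sRH hT) mulmxV.
by move=> <-; exact: subsetIr.
Qed.

Variables (K : fieldType) (G Q : {group gT}) (sQG : Q \subset G).
Variables (V : representation K G).

Local Notation H := 'N_G(Q)%G.

Lemma normal_vertex : (Q <| H)%g.
Proof. by rewrite /normal finset.subsetI sQG normG subsetIr. Qed.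

(** Mackey's formula for the cosets Qg outside H: the subgroups that occur are
    H /\ Q^g, and one of them contains Q only if g normalizes Q. *)
Lemma trace_normalizer A : mxhom Q V V A ->
  exists (I : finType) (P : pred I) (R : I -> {group gT})
         (y : I -> 'M_(rdegree V)),
    (forall j, P j ->
       [/\ R j \subset H, ~~ (Q \subset R j) & mxhom (R j) V V (y j)]) /\
    rel_trace Q G V V A =
      rel_trace Q H V V A + \sum_(j | P j) rel_trace (R j) H V V (y j).
Proof.
move=> hA; have [sQH nQH] := andP normal_vertex.
have sHG : H \subset G := subsetIl _ _.
have sHQ : rcosets Q H \subset rcosets Q G.
  apply/fintype.subsetP=> C /rcosetsP[x Hx ->]; apply/rcosetsP.
  by exists x => //; apply: (fintype.subsetP sHG).
pose S := rcosets Q G :\: rcosets Q H.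
have actS : [acts H, on S | 'Rs].
  apply: actsD; last exact: actsRs_rcosets.
  exact: fintype.subset_trans sHG (actsRs_rcosets _ _).
have [I [P [g [Gg eqS]]]] := trace_Mackey sQG sHG (subsetDl _ _) actS hA.
exists I, P, (fun j => Q :^ g j :&: H)%G, (fun j => conjm V V A (g j)); split.
  move=> j Pj; have [Gj] := Gg j Pj; rewrite inE => /andP[nHj _].
  split; first exact: subsetIr.
    apply: contra nHj => sQR.
    have sQ : Q \subset (Q :^ g j)%g.
      by apply: fintype.subset_trans sQR (subsetIl _ _).
    have eqQ : (Q :^ g j)%g = Q.
      by apply/esym/eqP; rewrite eqEcard sQ cardJg leqnn.
    by apply/rcosetsP; exists (g j) => //; rewrite !inE Gj eqQ /=.
  by apply: hom_sub (subsetIl _ _) _; apply: hom_conjm hA.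
rewrite -eqS /rel_trace /coset_sum (big_setID (rcosets Q H)) /=; congr (_ + _).
by apply: eq_bigl => C; rewrite (finset.setIidPr sHQ).
Qed.

End Green.

Section GreenExtension.

Variables (gT : finGroupType) (K E : fieldType) (f : {rmorphism K -> E}).
Variables (G Q : {group gT}) (sQG : Q \subset G) (V : representation K G).
Hypotheses (simV : simple V) (vV : vertex Q V).
Variable U : representation E 'N_G(Q)%G.

Local Notation H := 'N_G(Q)%G.
Local Notation "A ^f" := (map_mx f A) : ring_scope.

Hypotheses (indU : indecomposable U) (vU : vertex Q U).
Hypothesis UV : divides U (Res (subsetIl G 'N(Q)%g) (extend f V)).

(** The identity of U, seen as an endomorphism of the extended restriction of V,
    is a unit; by locality of End U some indecomposable summand Z of the
    restriction of V already induces a unit on U, so U divides the extension of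
    Z.  Hence every subgroup relative to which Z is projective serves for U as
    well, and this forces the vertex of Z to be Q. *)
Lemma exists_green_correspondent :
  exists Z : representation K H, green_correspondent V Z.
Proof.
have [sQH nQH] := andP (normal_vertex sQG);
  have sHG : H \subset G := subsetIl _ _.
have /dividesP[i [q [hi hq iq]]] := UV.
have /rel_projectiveP[A hA trA] := vertex_rel_projective sQG vV.
have hc X : mxhom H V V X -> mxhom H U U (i *m X^f *m q).
  by move=> hX; exact: homM (homM hi (hom_map f hX)) hq.
have [|X Y hX hY nX nY|/=|Z [j [r [indZ hj hr jr uZ]]]] :=
   @exists_summand _ _ _ (Res (subsetIl G 'N(Q)%g) V) (fun X =>
     i *m X^f *m q \notin unitmx).
- by rewrite map_mx0 mulmx0 mul0mx; apply: endo0_nonunit.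
- rewrite map_mxD mulmxDr mulmxDl;
    apply/negP=> /(endo_local indU (hc _ hX) (hc _ hY)).
  by rewrite (negPf nX) (negPf nY); case.
- by rewrite map_mx1 mulmx1 iq unitmx1.
have hjf := hom_map f hj; have hrf := hom_map f hr.
have {}uZ : i *m (r *m j)^f *m q \in unitmx by apply/negPn/negP.
have UZ : divides U (extend f Z).
  apply: (@divides_unit _ _ _ U (extend f Z) (i *m r^f) (j^f *m q)).
  - exact: homM hi hrf.
  - exact: homM hjf hq.
  - by move: uZ; rewrite map_mxM !mulmxA.
exists Z; split=> //; last by apply/dividesP; exists j, r.
exists sQH; split=> [|R sRH sRQ RZ].
  have [I [P [R [y [hR eqA]]]]] := trace_normalizer sQG hA.
  have sum1 : \sum_(k | P k) rel_trace (R k) H Z Z (j *m y k *m r)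
      + rel_trace Q H Z Z (j *m A *m r) = 1%:M.
    rewrite (@trace_split _ _ H Q Z (Res sHG V)) // -jr -[j in RHS]mulmx1.
    rewrite -trA eqA mulmxDr mulmxDl addrC; congr (_ + _).
    rewrite mulmx_sumr mulmx_suml; apply: eq_bigr => k /hR[sRH _ hy].
    exact: (@trace_split _ _ H (R k) Z (Res sHG V)).
  have hyk k : P k -> mxhom (R k) Z Z (j *m y k *m r).
    by case/hR=> sRH _ hy; exact: homM (homM (hom_sub sRH hj) hy)
      (hom_sub sRH hr).
  have hAj : mxhom Q Z Z (j *m A *m r) by exact: homM (homM
    (hom_sub sQH hj) hA) (hom_sub sQH hr).
  have hT1 k : P k -> mxhom H Z Z (rel_trace (R k) H Z Z (j *m y k *m r)).
    by move=> Pk; have [sRH _ _] := hR k Pk;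
      exact: hom_trace sRH (fintype.subxx H) (hyk k Pk).
  have u1 : (1%:M : 'M[K]_(rdegree Z)) \in unitmx by apply: unitmx1.
  rewrite -sum1 in u1.
  case/(endo_local indZ (hom_sum hT1) (hom_trace sQH
    (fintype.subxx H) hAj)): u1.
    case/(endo_local_sum indZ hT1)=> k Pk uk; have [sRH nQR _] := hR k Pk.
    have RZ := unit_trace_rel_projective sRH (hyk k Pk) uk.
    have /rel_projectiveP[B hB trB] := divides_rel_projective UZ
      (rel_projective_extend f RZ).
    case/negP: nQR; apply: (normal_vertex_trace
      (normal_vertex sQG) indU vU sRH hB).
    by rewrite trB unitmx1.
  exact: unit_trace_rel_projective hAj.
case: vU => sQH' [_]; apply; first exact: sRQ.
exact: divides_rel_projective UZ (rel_projective_extend f RZ).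
Qed.

(** Let r j be the projection of V on Z, e = Tr_Q^H(A) and B = r j A r j.  The
    endomorphism s = Tr_Q^G(B) of V is nonzero because it acts on Z as the unit
    j e r up to non-units.  It is then invertible, and the identity of U is the
    sum of a map factoring through the extension of Z (coming from Tr_Q^H(B))
    and of traces that are non-units on U. *)
Lemma green_correspondent_extend (Z : representation K H) :
  green_correspondent V Z -> divides U (extend f Z).
Proof.
case=> indZ vZ /dividesP[j [r [hj hr jr]]].
have nQH := normal_vertex sQG; have [sQH _] := andP nQH.
have sHG : H \subset G := subsetIl _ _.
have /dividesP[i [q [hi hq iq]]] := UV.
have /rel_projectiveP[A hA trA] := vertex_rel_projective sQG vV.
set e := rel_trace Q H V V A; have he : mxhom H V V e := hom_trace sQH sHG hA.
have hj' := hom_sub sQH hj; have hr' := hom_sub sQH hr.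
have nonunit (I : finType) (P : pred I) (R : I -> {group gT}) (y : I ->
  'M_(rdegree V)) :
    (forall k, P k -> [/\ R k \subset H,
      ~~ (Q \subset R k) & mxhom (R k) V V (y k)]) ->
  mxhom H Z Z (j *m (\sum_(k | P k) rel_trace (R k) H V V (y k)) *m r) /\
  j *m (\sum_(k | P k) rel_trace (R k) H V V (y k)) *m r \notin unitmx.
  move=> hR; rewrite mulmx_sumr mulmx_suml.
  have hT k : P k -> mxhom H Z Z (j *m rel_trace (R k) H V V (y k) *m r).
    move=> /hR[sRH _ hy]; apply: homM hr; apply: homM hj _;
      exact: hom_trace sRH sHG hy.
  split; first exact: hom_sum.
  apply/negP=> /(endo_local_sum indZ hT)[k Pk uk]; have [sRH nQR hy] := hR k Pk.
  have hy' : mxhom (R k) Z Z (j *m y k *m r).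
    exact: homM (homM (hom_sub sRH hj) hy) (hom_sub sRH hr).
  case/negP: nQR; apply: (normal_vertex_trace nQH indZ vZ sRH hy').
  by rewrite (@trace_split _ _ H (R k) Z (Res sHG V)).
have uje : j *m e *m r \in unitmx.
  have [I [P [R [y [hR eqA]]]]] := trace_normalizer sQG hA.
  have [hS nS] := nonunit _ _ _ _ hR.
  have : j *m e *m r + j *m (\sum_(k | P k) rel_trace (R k) H V V
    (y k)) *m r \in unitmx.
    by rewrite -mulmxDl -mulmxDr -eqA trA mulmx1 jr unitmx1.
  case/(endo_local indZ (homM (homM hj he) hr) hS) => // u.
  by rewrite u in nS.
pose B := r *m j *m A *m (r *m j).
have hrj := homM hr hj; have hrj' := hom_sub sQH hrj.
have hB : mxhom Q V V B := homM (homM hrj' hA) hrj'.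
have [I [P [R [y [hR eqB]]]]] := trace_normalizer sQG hB.
have trHB : rel_trace Q H V V B = r *m j *m e *m (r *m j).
  exact: (@trace_split _ _ H Q (Res sHG V) (Res sHG V)).
set s := rel_trace Q G V V B in eqB.
have hs : mxhom G V V s := hom_trace sQG (fintype.subxx G) hB.
have nzs : s != 0.
  apply/eqP=> s0; have [hS nS] := nonunit _ _ _ _ hR.
  have := congr1 (fun X => j *m X *m r) eqB; rewrite s0 mulmx0 mul0mx.
  rewrite mulmxDr mulmxDl trHB !mulmxA jr mul1mx -[_ *m j *m r]mulmxA jr mulmx1.
  move/esym/eqP; rewrite addr_eq0 => /eqP eq_jer.
  by move: uje; rewrite eq_jer -scaleN1r unitmxZ ?unitrN1 // (negPf nS).
have us := simple_end_unit simV hs nzs.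
have hs' := homV us hs; have hs'H := hom_sub sHG hs'.
set s' := invmx s in hs' hs'H.
pose M1 := i *m r^f; pose M2 := (j *m e *m (r *m j) *m s')^f *m q.
have hM1 : mxhom H U (extend f Z) M1 by exact: homM hi (hom_map f hr).
have hM2 : mxhom H (extend f Z) U M2.
  apply: homM hq; apply: hom_map; exact: homM (homM (homM hj he) hrj) hs'H.
apply: (divides_unit hM1 hM2).
have hT k : P k -> mxhom H U U (i *m (rel_trace (R k) H V V
  (y k) *m s')^f *m q).
  move=> /hR[sRH _ hy]; apply: homM hq; apply: homM hi _; apply: hom_map.
  by apply: homM hs'H; exact: hom_trace sRH sHG hy.
have : M1 *m M2 + \sum_(k | P k) i *m (rel_trace (R k) H V V
  (y k) *m s')^f *m q \in unitmx.
  rewrite -mulmx_suml -mulmx_sumr -raddf_sum -mulmx_suml.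
  have -> : M1 *m M2 = i *m (rel_trace Q H V V B *m s')^f *m q.
    by rewrite trHB /M1 /M2 !map_mxM !mulmxA.
  by rewrite -mulmxDl -mulmxDr -map_mxD -mulmxDl -eqB mulmxV // map_mx1 mulmx1
    iq unitmx1.
case/(endo_local indU (homM hM1 hM2) (hom_sum hT)) => //.
case/(endo_local_sum indU hT)=> k Pk; have [sRH nQR hy] := hR k Pk.
rewrite -(trace_mulr _ _ sRH hs'H) map_trace.
have hyk := homM hy (hom_sub sRH hs'H).
rewrite -(@trace_split _ _ H (R k) U (Res sHG (extend f V))) // => uk.
case/negP: nQR; apply: (normal_vertex_trace nQH indU vU sRH _ uk).
exact: homM (homM (hom_sub sRH hi) (hom_map f hyk)) (hom_sub sRH hq).
Qed.

End GreenExtension.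

(** * Simple factors *)

Section SimpleFactors.

Variables (gT : finGroupType) (K : fieldType) (G : {group gT}).
Implicit Types U V : representation K G.

Lemma hom_inverse U V (A : 'M_(rdegree U, rdegree V)) :
  mxhom G U V A -> row_free A -> row_full A ->
  exists B, [/\ mxhom G V U B, A *m B = 1%:M & B *m A = 1%:M].
Proof.
move=> hA /row_freeP[B AB] /row_fullP[C CA]; exists B.
have eqBC : B = C by rewrite -[C]mulmx1 -AB mulmxA CA mul1mx.
split=> //; last by rewrite eqBC.
move=> g Gg; rewrite -[LHS]mul1mx -CA -eqBC -!mulmxA [A *m _]mulmxA -hA //.
by rewrite -!mulmxA AB mulmx1.
Qed.

Lemma hom_simple_full U V (A : 'M_(rdegree U, rdegree V)) :
  simple V -> mxhom G U V A -> A != 0 -> row_full A.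
Proof.
move=> simV hA nzA; have [_ minV] := (mx_irrP V).1 simV.
rewrite -sub1mx -(genmxE A) sub1mx; apply: minV;
  last by rewrite (eqmx_eq0 (genmxE A)).
by rewrite (eqmx_module _ (genmxE A)); apply/mxmoduleP=> g Gg;
  rewrite -hA // submxMl.
Qed.

Lemma hom_simple_free U V (A : 'M_(rdegree U, rdegree V)) :
  simple U -> mxhom G U V A -> A != 0 -> row_free A.
Proof.
move=> simU hA nzA; have [_ minU] := (mx_irrP U).1 simU.
rewrite -kermx_eq0; apply: contraNT nzA => nzK.
have /(minU _)/(_ nzK) := kermx_module hA.
by rewrite -sub1mx => /sub_kermxP; rewrite mul1mx => ->.
Qed.

Lemma hom_simple_iso U V (A : 'M_(rdegree U, rdegree V)) :
  simple U -> simple V -> mxhom G U V A -> A != 0 -> iso U V.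
Proof.
move=> simU simV hA nzA.
have [B [hB AB BA]] := hom_inverse hA (hom_simple_free simU hA nzA)
  (hom_simple_full simV hA nzA).
by apply/isoP; exists A, B.
Qed.

(** Induction on the degree: a module satisfying P that is not simple can be
    traded for a proper submodule or a proper quotient. *)
Lemma simple_factor_ind (P : representation K G -> Prop) U :
  (forall V, P V -> (0 < rdegree V)%N) ->
  (forall V (N : 'M_(rdegree V)) (modN : mxmodule V N), P V ->
     P (Representation (submod_repr modN)) \/
     P (Representation (factmod_repr modN))) ->
  P U -> exists2 S, simple S & P S.
Proof.
move=> P_gt0 Pstep; have [r] := ubnP (rdegree U).
elim: r U => // r IHr U /ltnSE-leUr PU.
have [simU | nsimU] := pselect (simple U); first by exists U.
have [N [modN nzN nfullN]] : exists N : 'M_(rdegree U), [/\ mxmodule U N,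
  N != 0 & ~~ row_full N].
  apply: contrapT => noN; apply: nsimU; apply/mx_irrP; split;
    first exact: P_gt0.
  move=> N modN nzN; apply: contrapT => /negP nf; apply: noN; by exists N.
have ltN : (\rank N < rdegree U)%N by rewrite ltn_neqAle rank_leq_col andbT.
have [] := Pstep U N modN PU; apply: IHr; apply: leq_trans leUr => //=.
by rewrite mxrank_coker ltn_subrL lt0n mxrank_eq0 nzN P_gt0.
Qed.

Lemma hom_in_factmod U (N : 'M_(rdegree U)) (modN : mxmodule U N) :
  mxhom G U (Representation (factmod_repr modN)) (in_factmod N 1%:M).
Proof.
move=> g Gg; rewrite /= -in_factmodJ // mul1mx.
by rewrite -in_factmodE.
Qed.

Lemma exists_simple_quotient U : (0 < rdegree U)%N ->
  exists (S : representation K G) (A : 'M_(rdegree U, rdegree S)),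
    [/\ simple S, mxhom G U S A & A != 0].
Proof.
move=> U_gt0.
pose P (S : representation K G) := exists2 A : 'M_(rdegree U, rdegree S),
  mxhom G U S A & A != 0.
have [|||S simS [A hA nzA]] := simple_factor_ind (P := P) (U := U).
- move=> V [A _]; apply: contraNT; rewrite -leqNgt leqn0 => /eqP V0.
  by rewrite -mxrank_eq0 -leqn0 -[X in (_ <= X)%N]V0 rank_leq_col.
- move=> V N modN [A hA nzA].
  have [sAN | nsAN] := boolP (A <= N)%MS; [left | right].
    exists (in_submod N A).
      by move=> g Gg /=; rewrite -in_submodJ // -hA // /in_submod /= !mulmxA.
    by apply: contra nzA => /eqP A0; rewrite -(in_submodK sAN) A0 linear0.
  exists (A *m in_factmod N 1%:M); first exact: homM hA (hom_in_factmod modN).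
  by rewrite -in_factmodE in_factmod_eq0.
- by exists 1%:M; [exact: hom1 | rewrite -mxrank_eq0 mxrank1 -lt0n].
by exists S, A.
Qed.

Lemma reducible_quotient_divides U V (A : 'M_(rdegree U, rdegree V)) :
  mx_completely_reducible U 1%:M -> simple V -> mxhom G U V A -> A != 0 ->
  divides V U.
Proof.
move=> redU simV hA nzA.
have modK := kermx_module hA.
have [C modC sumKC dxKC] := redU _ modK (submx1 _).
pose D := val_submod (1%:M : 'M_(\rank C)).
pose S := Representation (submod_repr modC).
have hD : mxhom G S U D := hom_val_submod modC.
have hDA := homM hD hA.
have fullDA : row_full (D *m A).
  apply: hom_simple_full simV hDA _; apply: contra nzA => /eqP DA0.
  have : (1%:M <= kermx A)%MS.
    rewrite -sumKC addsmx_sub submx_refl /= -(val_submod1 C).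
    exact/sub_kermxP.
  by move/sub_kermxP; rewrite mul1mx => ->.
have freeDA : row_free (D *m A).
  apply: inj_row_free => v; rewrite mulmxA => /sub_kermxP vK.
  have: (v *m D <= kermx A :&: C)%MS
    by rewrite sub_capmx vK -val_submodE val_submodP.
  rewrite (mxdirect_addsP dxKC) submx0 -val_submodE => /eqP vD0.
  by apply/eqP; move/eqP: vD0; rewrite val_submod_eq0.
have [B [hB DAB BDA]] := hom_inverse hDA freeDA fullDA.
apply/dividesP; exists (B *m D), A; split=> //; last by rewrite -mulmxA.
exact: homM hB hD.
Qed.

End SimpleFactors.

Section SimpleBelow.

Variables (gT : finGroupType) (K E : fieldType) (f : {rmorphism K -> E}).
Variable (G : {group gT}).
Local Notation "A ^f" := (map_mx f A) : ring_scope.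

(** X is a quotient of the regular module, which is defined over K.  For a
    submodule N of W, a nonzero map from the extension of W to X is nonzero on
    the extension of N or factors through that of W / N. *)
Lemma exists_simple_below (X : representation E G) : simple X ->
  exists (W : representation K G) (A : 'M_(rdegree W, rdegree X)),
    [/\ simple W, mxhom G (extend f W) X A & A != 0].
Proof.
move=> simX.
pose P (W : representation K G) := exists2 A : 'M_(rdegree W, rdegree X),
  mxhom G (extend f W) X A & A != 0.
have [|||W simW [A hA nzA]] := simple_factor_ind (P := P) (U := Representation
  (regular_repr K G)).
- move=> V [A _]; apply: contraNT; rewrite -leqNgt leqn0 => /eqP V0.
  by rewrite -mxrank_eq0 -leqn0 -[X in (_ <= X)%N]V0 rank_leq_row.
- move=> V N modN [A hA nzA]; pose D := val_submod (1%:M : 'M_(\rank N)).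
  have [DA0 | nzDA] := eqVneq (D^f *m A) 0; [right | left]; last first.
    exists (D^f *m A) => //; apply: homM hA.
    exact: (@hom_map _ _ _ f G G G (Representation (submod_repr modN)) V _
      (hom_val_submod modN)).
  pose F := val_factmod (1%:M : 'M_(\rank (cokermx N))).
  pose I := in_factmod N (1%:M : 'M_(rdegree V)).
  have FI : F *m I = 1%:M by rewrite -in_factmodE val_factmodK.
  have defA : A = I^f *m (F^f *m A).
    rewrite mulmxA -map_mxM -val_factmodE.
    rewrite -{1}[A]mul1mx -(map_mx1 f) -{1}(add_sub_fact_mod N 1%:M).
    by rewrite map_mxD mulmxDl val_submodE map_mxM -mulmxA DA0 mulmx0 add0r.
  exists (F^f *m A); last by apply: contra nzA => /eqP FA0;
    rewrite defA FA0 mulmx0.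
  have hI := hom_map f (hom_in_factmod modN).
  move=> g Gg; set Y := F^f *m A in defA *.
  have FIf : F^f *m I^f = 1%:M by rewrite -map_mxM FI map_mx1.
  rewrite -[LHS]mul1mx -[RHS]mul1mx -FIf -!mulmxA; congr (_ *m _).
  rewrite (mulmxA F^f A) (mulmxA I^f (F^f *m A)) -[I^f *m (F^f *m A)]defA.
  rewrite -hA // defA !mulmxA; congr (_ *m _).
  by rewrite -(hI g Gg).
- have [U [modU /= simXU]] := rsim_regular_factmod simX.
  have /isoP[A [B [hA hB AB BA]]] : iso X (Representation
    (factmod_repr modU)) by [].
  exists (in_factmod U 1%:M *m B).
    apply: homM hB => g Gg.
    rewrite -[LHS]/(map_repr f (regular_repr K G) g *m _) map_regular_repr.
    exact: (@hom_in_factmod _ _ _ (Representation (regular_repr E G)) U modU).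
  have FI : val_factmod (1%:M : 'M_(\rank
    (cokermx U))) *m in_factmod U 1%:M = 1%:M.
    by rewrite -in_factmodE val_factmodK.
  apply/eqP => IB0; have [+ _] := (mx_irrP X).1 simX; rewrite lt0n => /eqP;
    apply.
  apply/eqP; rewrite -leqn0 -[X in (X <= _)%N](mxrank1 E) -AB -[B]mul1mx -FI.
  by rewrite -(mulmxA _ _ B) IB0 !mulmx0 mxrank0.
by exists W, A.
Qed.

End SimpleBelow.

(** * Semisimplicity of the extension of a simple module *)

Section Frobenius.

Variables (p : nat) (p_prime : prime p) (E : fieldType).
Variable iota : {rmorphism 'F_p -> E}.

Lemma pchar_extension : p \in [pchar E].
Proof.
exact: (rmorph_pchar iota (pchar_Fp p_prime)).
Qed.

Lemma fixed_by_Frobenius (x : E) : x ^+ p = x -> exists a, x = iota a.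
Proof.
move=> xp; apply: contrapT => notin.
have p_gt1 := prime_gt1 p_prime.
pose q : {poly E} := 'X^p - 'X.
have size_q : size q = p.+1.
  by rewrite size_polyDl ?size_polyN ?size_polyXn ?size_polyX.
have nzq : q != 0 by rewrite -size_poly_eq0 size_q.
pose s := x :: [seq iota a | a <- enum 'F_p].
have := max_poly_roots nzq (rs := s).
rewrite size_q /= size_map -cardE card_Fp // ltnn.
have fp (a : 'F_p) : a ^+ p = a by rewrite -{2}(expf_card a) card_Fp.
rewrite /root !hornerE xp subrr eqxx /=.
have -> : all (root q) [seq iota a | a <- enum 'F_p].
  by apply/allP=> _ /mapP[a _ ->]; rewrite /root !hornerE -rmorphXn fp subrr.
rewrite map_inj_uniq ?enum_uniq ?andbT; last exact: fmorph_inj.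
move=> /(_ isT) H; suff /H : x \notin [seq iota a | a <- enum 'F_p] by [].
by apply/mapP=> -[a _ xa]; apply: notin; exists a.
Qed.

Local Notation phi := (pFrobenius_aut pchar_extension).

Lemma Frobenius_iota a : phi (iota a) = iota a.
Proof. by rewrite pFrobenius_autE -rmorphXn -{2}(expf_card a) card_Fp. Qed.

(** Take a nonzero vector u of minimal support with an entry equal to 1: the
    difference between u and its image by Frobenius has smaller support, so it
    vanishes. *)
Lemma Frobenius_stable_rational n m (V : 'M[E]_(m, n)) :
  V != 0 -> (map_mx phi V <= V)%MS ->
  exists2 v : 'rV['F_p]_n, v != 0 & (map_mx iota v <= V)%MS.
Proof.
move=> nzV sV.
pose supp (v : 'rV[E]_n) := #|[set j | v 0 j != 0]|.
have exv : exists k, `[< exists v : 'rV[E]_n, [/\ v != 0,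
  (v <= V)%MS & supp v = k] >].
  have /rowV0Pn[v vV nzv] := nzV; exists (supp v); apply/asboolP; by exists v.
case: (ex_minnP exv) => k /asboolP[v [nzv vV sv]] mink.
have [j nzj] : exists j, v 0 j != 0.
  by have /rV0Pn := nzv.
pose u := (v 0 j)^-1 *: v.
have uj : u 0 j = 1 by rewrite mxE mulVf.
have uV : (u <= V)%MS by rewrite scalemx_sub.
have nzu i : (u 0 i != 0) = (v 0 i != 0) by rewrite mxE mulf_eq0 invr_eq0
  (negPf nzj).
move: u uj uV nzu => u uj uV nzu.
have fixu : map_mx phi u = u.
  apply/eqP; rewrite -subr_eq0; apply: contraT => nzd.
  have dV : (map_mx phi u - u <= V)%MS.
    rewrite addmx_sub ?eqmx_opp //; apply: submx_trans sV; by rewrite map_submx.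
  have /mink : `[< exists v : 'rV[E]_n, [/\ v != 0,
    (v <= V)%MS & supp v = supp (map_mx phi u - u)] >].
    by apply/asboolP; exists (map_mx phi u - u).
  rewrite -sv leqNgt => /negP[]; apply: proper_card; apply/properP; split.
    apply/fintype.subsetP=> i; rewrite !inE -nzu; apply: contraNN => /eqP ui.
    by rewrite !mxE ui rmorph0 subrr.
  by exists j; rewrite !inE // negbK !mxE uj rmorph1 subrr.
have fixui i : u 0 i ^+ p = u 0 i by rewrite -{2}fixu mxE pFrobenius_autE.
have [w wP] := choice (fun i => fixed_by_Frobenius (fixui i)).
have uw : map_mx iota (\row_i w i) = u by apply/rowP=> i; rewrite !mxE -wP.
exists (\row_i w i); last by rewrite uw.
apply/eqP=> w0; move: uj; rewrite -uw w0 map_mx0 mxE => /esym/eqP;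
  by rewrite oner_eq0.
Qed.

Section Semisimple.

Variables (gT : finGroupType) (G : {group gT}) (W : representation 'F_p G).
Hypothesis simW : simple W.
Local Notation WE := (extend iota W).
Local Notation n := (rdegree W).

(** The rational vectors of V generate a submodule of the simple module W. *)
Lemma Frobenius_stable_full (V : 'M[E]_n) :
  mxmodule WE V -> V != 0 -> (map_mx phi V <= V)%MS -> (1%:M <= V)%MS.
Proof.
move=> modV nzV stV; have [v nzv vV] := Frobenius_stable_rational nzV stV.
have [_ minW] := (mx_irrP W).1 simW.
pose M := (\sum_(g in G) <<v *m W g>>)%MS.
have modM : mxmodule W M.
  apply/mxmoduleP=> h Gh; rewrite sumsmxMr_gen; apply/sumsmx_subP=> g Gg.
  rewrite genmxE (eqmxMr _ (genmxE _)) -mulmxA -repr_mxM //.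
  by apply: (sumsmx_sup (g * h)%g); rewrite ?groupM // genmxE.
have nzM : M != 0.
  apply: contra nzv => /eqP M0; rewrite -submx0 -M0 (sumsmx_sup 1%g) //.
  by rewrite genmxE repr_mx1 mulmx1.
have fullM := minW M modM nzM.
have : (map_mx iota M <= V)%MS.
  rewrite /M; elim/big_rec: _ => [|g B Gg IH]; first by rewrite map_mx0 sub0mx.
  rewrite map_addsmx addsmx_sub IH andbT map_genmx genmxE map_mxM.
  by apply: submx_trans (submxMr _ vV) _; apply: (mxmoduleP modV).
by apply: submx_trans; rewrite sub1mx /row_full mxrank_map.
Qed.

Lemma map_phi_module (V : 'M[E]_n) : mxmodule WE V ->
  mxmodule WE (map_mx phi V).
Proof.
move=> /mxmoduleP modV; apply/mxmoduleP=> g Gg.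
have -> : WE g = map_mx phi (WE g).
  by apply/matrixP=> i j; rewrite !mxE [RHS]Frobenius_iota.
by rewrite -map_mxM map_submx modV.
Qed.

(** Nonzero submodules of least dimension are simple, and Frobenius maps them
    to one another.  A sum of such submodules of maximal dimension contains all
    of them, so it is stable under Frobenius, hence it is the whole module.  The
    statement is truncated because complete reducibility is a type whose
    inhabitants carry complements. *)
Lemma simple_extend_reducible : inhabited (mx_completely_reducible WE 1%:M).
Proof.
have [n_gt0 _] := (mx_irrP W).1 simW.
have nz1 : (1%:M : 'M[E]_n) != 0 by rewrite -mxrank_eq0 mxrank1 -lt0n.
have exr : exists r, `[< exists M : 'M[E]_n, [/\ mxmodule WE M,
  M != 0 & \rank M = r] >].
  by exists n; apply/asboolP; exists 1%:M; rewrite mxmodule1 mxrank1.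
case: (ex_minnP exr) => r /asboolP[M0 [modM0 nzM0 rM0]] minr.
have r_gt0 : (0 < r)%N by rewrite -rM0 lt0n mxrank_eq0.
have simM (M : 'M[E]_n) : mxmodule WE M -> \rank M = r -> mxsimple WE M.
  move=> modM rM; split=> // [|N modN sNM nzN];
    first by rewrite -mxrank_eq0 rM -lt0n.
  rewrite -(geq_leqif (mxrank_leqif_sup sNM)) rM; apply: minr.
  by apply/asboolP; exists N.
pose sumM (s : seq 'M[E]_n) := (\sum_(M <- s) M)%MS.
pose good (s : seq 'M[E]_n) := forall M, M \in s ->
  mxmodule WE M /\ \rank M = r.
have exs : exists k, `[< exists2 s, good s & \rank (sumM s) = k >].
  by exists (\rank (sumM [:: M0])); apply/asboolP; exists [:: M0] => // M;
    rewrite inE => /eqP->.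
have bnd k : `[< exists2 s, good s & \rank (sumM s) = k >] -> (k <= n)%N.
  by case/asboolP=> s _ <-; apply: rank_leq_row.
case: (ex_maxnP exs bnd) => k /asboolP[s gs rs] maxk.
have absorb (N : 'M[E]_n) : mxmodule WE N -> \rank N = r -> (N <= sumM s)%MS.
  move=> modN rN.
  have gNs : good (N :: s) by move=> M; rewrite inE => /predU1P[-> // | /gs].
  have sN : (sumM s <= sumM (N :: s))%MS by rewrite /sumM big_cons addsmxSr.
  have /(submx_trans _) : (sumM (N :: s) <= sumM s)%MS.
    rewrite -(geq_leqif (mxrank_leqif_sup sN)) rs; apply: maxk.
    by apply/asboolP; exists (N :: s).
  by apply; rewrite /sumM big_cons addsmxSl.
have semis : mxsemisimple WE (sumM s).
  rewrite /sumM; elim: (s) gs => [|M t IHt] gt; first by rewrite big_nil;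
    apply: mxsemisimple0.
  rewrite big_cons; apply: addsmx_semisimple.
    by apply: mxsimple_semisimple; have [] := gt M; rewrite ?mem_head // => *;
      apply: simM.
  by apply: IHt => N tN; apply: gt; rewrite inE tN orbT.
have full : (1%:M <= sumM s)%MS.
  apply: Frobenius_stable_full.
  - exact: mxsemisimple_module semis.
  - apply: contra nzM0 => /eqP s0; rewrite -submx0 -s0; exact: absorb.
  - rewrite {1}/sumM; have : {subset s <= s} by [].
    elim: {1 3}s => [|M t IHt] st; first by rewrite big_nil map_mx0 sub0mx.
    rewrite big_cons map_addsmx addsmx_sub IHt ?andbT; last by move=> N tN;
      apply: st; rewrite inE tN orbT.
    have [modM rM] := gs M (st M (mem_head _ _)).
    by apply: absorb; [apply: map_phi_module | rewrite mxrank_map].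
constructor; apply: mxsemisimple_reducible; apply: eqmx_semisimple semis.
by apply/eqmxP; rewrite submx1.
Qed.

End Semisimple.

End Frobenius.

(** * Finite subfields *)

Section FiniteSubfields.

Variables (p : nat) (p_prime : prime p) (E : fieldType).
Variable iota : {rmorphism 'F_p -> E}.
Local Notation pcharE := (pchar_extension p_prime iota).

Definition frobenius_fixed (n : nat) : pred E := fun x => x ^+ (p ^ n) == x.

Lemma exprB_pchar_pow n (x y : E) :
  (x - y) ^+ (p ^ n) = x ^+ (p ^ n) - y ^+ (p ^ n).
Proof.
have pn : [pchar E].-nat (p ^ n)%N by rewrite pnatX (pnatE _ p_prime) pcharE.
by rewrite exprDn_pchar // exprNn_pchar.
Qed.

Lemma frobenius_fixed_divring n : divring_closed (frobenius_fixed n).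
Proof.
split=> [|x y|x y]; rewrite !unfold_in /frobenius_fixed.
- by rewrite expr1n.
- by move=> /eqP Kx /eqP Ky; rewrite exprB_pchar_pow Kx Ky.
- by move=> /eqP Kx /eqP Ky; rewrite expr_div_n Kx Ky.
Qed.

Lemma frobenius_fixedM (x : E) n k : x ^+ (p ^ n) = x -> x ^+ (p ^ (n * k)) = x.
Proof.
move=> xn; elim: k => [|k IHk]; first by rewrite muln0 expr1.
by rewrite mulnS expnD exprM xn.
Qed.

(** The iterated Frobenius images of x are roots of the same polynomial, so two
    of them coincide; Frobenius being injective, x itself is periodic. *)
Lemma algebraic_frobenius_fixed x : algebraicOver iota x ->
  exists2 n, (0 < n)%N & x ^+ (p ^ n) = x.
Proof.
case=> q nzq rqx; pose q' := map_poly iota q.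
have nzq' : q' != 0 by rewrite map_poly_eq0.
pose s := [seq x ^+ (p ^ k) | k <- seq.iota 0 (size q')].
have rooted k : root q' (x ^+ (p ^ k)).
  elim: k => [|k IHk]; first by rewrite expr1.
  rewrite expnSr exprM -(pFrobenius_autE pcharE).
  have -> : q' = map_poly (pFrobenius_aut pcharE) q'.
    by apply/polyP=> i; rewrite !coef_map /=;
      apply: esym (Frobenius_iota p_prime _ _).
  exact: rmorph_root.
have /uniqPn : ~~ uniq s.
  apply/negP=> us; have := max_poly_roots nzq' _ us.
  rewrite size_map size_iota ltnn => H; suff /H : all (root q') s by [].
  by apply/allP=> _ /mapP[k _ ->].
case/(_ 0)=> i [j [ltij]]; rewrite size_map size_iota => ltj.
have lti := ltn_trans ltij ltj.
rewrite !(nth_map 0%N) ?size_iota // !nth_iota // !add0n => eqx.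
exists (j - i)%N; first by rewrite subn_gt0.
apply/eqP; rewrite -subr_eq0; have := exprB_pchar_pow i (x ^+ (p ^ (j - i))) x.
by rewrite -exprM -expnD subnK 1?ltnW // eqx subrr => /eqP;
  rewrite expf_eq0 => /andP[].
Qed.

Lemma algebraic_seq_frobenius_fixed (s : seq E) :
  (forall x, algebraicOver iota x) ->
  exists2 n, (0 < n)%N & {subset s <= frobenius_fixed n}.
Proof.
move=> alg; elim: s => [|x s [n n_gt0 IH]]; first by exists 1%N.
have [m m_gt0 xm] := algebraic_frobenius_fixed (alg x).
exists (n * m)%N; first by rewrite muln_gt0 n_gt0.
move=> y; rewrite inE => /predU1P[-> | /IH/eqP ys]; apply/eqP.
  by rewrite mulnC frobenius_fixedM.
exact: frobenius_fixedM.
Qed.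

Lemma frobenius_fixed_finite n : (0 < n)%N ->
  finite_set [set x | frobenius_fixed n x].
Proof.
move=> n_gt0; pose q : {poly E} := 'X^(p ^ n) - 'X.
have p_gt1 := prime_gt1 p_prime.
have pn_gt1 : (1 < p ^ n)%N by rewrite -(exp1n n) ltn_exp2r.
have size_q : size q = (p ^ n).+1.
  by rewrite size_polyDl ?size_polyN ?size_polyXn ?size_polyX.
have nzq : q != 0 by rewrite -size_poly_eq0 size_q.
have rootq x : root q x = frobenius_fixed n x
  by rewrite /root !hornerE subr_eq0.
pose P k := `[< exists s, [/\ uniq s, all (root q) s & size s = k] >].
have exP : exists k, P k by exists 0%N; apply/asboolP; exists [::].
have bP k : P k -> (k <= size q)%N.
  by case/asboolP=> s [us rs <-]; apply: ltnW; apply: max_poly_roots.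
case: (ex_maxnP exP bP) => k /asboolP[s [us rs sk]] maxk.
apply: (@sub_finite_set _ _ [set` s]); last exact: finite_seq.
move=> x /= Kx; apply: contraT => xs.
have : P k.+1.
  by apply/asboolP; exists (x :: s); rewrite /= xs us rs rootq Kx sk.
by move/maxk; rewrite ltnn.
Qed.

Lemma exists_finite_subfield (s : seq E) : (forall x, algebraicOver iota x) ->
  exists K : divringClosed E, finite_set [set x | x \in K] /\ {subset s <= K}.
Proof.
move=> /(algebraic_seq_frobenius_fixed s)[n n_gt0 sn].
pose K : divringClosed E := HB.pack (frobenius_fixed n)
  (GRing.isDivringClosed.Build E _ (frobenius_fixed_divring n)).
exists K; split; last exact: sn.
exact: frobenius_fixed_finite.
Qed.

End FiniteSubfields.

Local Open Scope classical_set_scope.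

(** * Descent to a finite subfield and the relation with Sigma *)

Section Descent.

Variables (E : fieldType) (K : divringClosed E).

Definition descend n m (A : 'M[E]_(n, m)) : 'M[subfield K]_(n, m) :=
  map_mx (insubd (0 : subfield K)) A.

Lemma descendK n m (A : 'M[E]_(n, m)) :
  (forall i j, A i j \in K) -> map_mx val (descend A) = A.
Proof. by move=> KA; apply/matrixP=> i j; rewrite !mxE insubdK. Qed.

Lemma map_val_inj n m :
  injective (fun A : 'M[subfield K]_(n, m) => map_mx val A).
Proof.
move=> A B /matrixP eqAB; apply/matrixP=> i j.
by have := eqAB i j; rewrite !mxE => /val_inj.
Qed.

Variables (gT : finGroupType) (G : {group gT}) (X : representation E G).
Hypothesis KX : forall g i j, X g i j \in K.

Lemma descend_mx_repr : mx_repr G (fun g => descend (X g)).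
Proof.
split=> [|g h Gg Gh]; apply: map_val_inj.
  by rewrite descendK // repr_mx1 map_mx1.
by rewrite map_mxM !descendK // repr_mxM.
Qed.

Definition descend_repr : representation (subfield K) G :=
  Representation (MxRepresentation descend_mx_repr).

Lemma extend_descend : iso (extend val descend_repr) X.
Proof.
have eqX g : extend val descend_repr g = X g by apply: descendK.
by apply/isoP; exists 1%:M, 1%:M; split; rewrite ?mulmx1 // => g Gg;
  rewrite mulmx1 mul1mx eqX.
Qed.

End Descent.

Section ModulesOverPrimeField.

Variables (p : nat) (p_prime : prime p) (Fbar : fieldType).
Variable iota : {rmorphism 'F_p -> Fbar}.
Variables (gT : finGroupType) (G : {group gT}).
Implicit Types (X : representation Fbar G) (W : representation 'F_p G).

Lemma extend_prime_incl (K : divringClosed Fbar) W :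
  iso (extend val (extend (prime_incl K iota) W)) (extend iota W).
Proof.
have eqW g : (extend val (extend (prime_incl K iota) W)) g = (extend iota W) g.
  by apply/matrixP=> i j; rewrite !mxE /= val_prime_incl.
by apply/isoP; exists 1%:M, 1%:M; split; rewrite ?mulmx1 // => g Gg;
  rewrite mulmx1 mul1mx eqW.
Qed.

(** The finite subfield K contains the entries of X and those of the two maps
    that split X off the extension of W. *)
Lemma divides_finite_subfield X W :
  (forall x : Fbar, algebraicOver iota x) ->
  divides X (extend iota W) ->
  exists (K : divringClosed Fbar) (V : representation (subfield K) G),
    [/\ finite_set [set x | x \in K], iso (extend val V) X
      & divides V (extend (prime_incl K iota) W)].
Proof.
move=> alg /dividesP[A [B [hA hB AB]]].
pose entries n m (M : 'M[Fbar]_(n, m)) := codom (fun u : 'I_n * 'I_m =>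
  M u.1 u.2).
pose entriesX := codom (fun u : gT * ('I_(rdegree X) * 'I_(rdegree X)) =>
  X u.1 u.2.1 u.2.2).
have inE n m (M : 'M[Fbar]_(n, m)) i j : M i j \in entries n m M.
  exact: (codom_f (fun u : 'I_n * 'I_m => M u.1 u.2) (i, j)).
pose s := entriesX ++ entries _ _ A ++ entries _ _ B.
have [K [finK sK]] := exists_finite_subfield p_prime s alg.
have KX g i j : X g i j \in K.
  apply: sK; rewrite mem_cat; apply/orP; left.
  exact: (codom_f (fun u : gT * ('I__ * 'I__) =>
    X u.1 u.2.1 u.2.2) (g, (i, j))).
have KA i j : A i j \in K.
  by apply: sK; rewrite !mem_cat inE orbT.
have KB i j : B i j \in K.
  by apply: sK; rewrite !mem_cat inE !orbT.
exists K, (descend_repr KX); split=> //; first exact: extend_descend.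
have eqW g : map_mx val (extend (prime_incl K iota) W g) = extend iota W g.
  by apply/matrixP=> i j; rewrite !mxE /= val_prime_incl.
apply/dividesP; exists (descend K A), (descend K B); split=> [g Gg|g Gg|];
  apply: map_val_inj.
- by rewrite !map_mxM !descendK // eqW hA.
- by rewrite !map_mxM !descendK // eqW hB.
- by rewrite map_mxM !descendK // AB map_mx1.
Qed.

Lemma divides_of_extend X (K : divringClosed Fbar)
    (V : representation (subfield K) G) W :
  divides V (extend (prime_incl K iota) W) -> iso (extend val V) X ->
  divides X (extend iota W).
Proof.
move=> VW VX; apply: divides_trans (iso_divides (iso_sym VX)) _.
exact: divides_trans (divides_extend val VW) (iso_divides
  (extend_prime_incl K W)).
Qed.

Lemma exists_divides_extend X : simple X ->
  exists2 W, simple W & divides X (extend iota W).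
Proof.
move=> simX; have [W [A [simW hA nzA]]] := exists_simple_below iota simX.
exists W => //; have [redW] := simple_extend_reducible p_prime iota simW.
exact: reducible_quotient_divides redW simX hA nzA.
Qed.

Lemma exists_divided_by W : simple W ->
  exists2 X, simple X & divides X (extend iota W).
Proof.
move=> simW; have [W_gt0 _] := (mx_irrP W).1 simW.
have [X [A [simX hA nzA]]] := @exists_simple_quotient _ _ _
  (extend iota W) W_gt0.
exists X => //; have [redW] := simple_extend_reducible p_prime iota simW.
exact: reducible_quotient_divides redW simX hA nzA.
Qed.

Lemma divides_extend_unique X W W' : simple X -> simple W -> simple W' ->
  divides X (extend iota W) -> divides X (extend iota W') -> iso W W'.
Proof.
move=> simX simW simW' /dividesP[A [B [hA hB AB]]]
  /dividesP[A' [B' [hA' hB' AB']]].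
have nz : B *m A' != 0.
  apply/eqP=> BA0; have : A *m (B *m A') *m B' = 1%:M
    by rewrite mulmxA AB mul1mx AB'.
  rewrite BA0 mulmx0 mul0mx => /(congr1 mxrank); rewrite mxrank0 mxrank1 => X0.
  by have [+ _] := (mx_irrP X).1 simX; rewrite -X0.
have [C hC nzC] := hom_descent (homM hB hA') nz.
exact: hom_simple_iso simW simW' hC nzC.
Qed.

End ModulesOverPrimeField.

(** * The theorem *)

Lemma vertex_transfer (gT : finGroupType) (K L : fieldType) (G Q : {group gT})
    (V : representation K G) (W : representation L G) :
  (forall (R : {group gT}) (sRG : R \subset G),
    rel_projective sRG V <-> rel_projective sRG W) ->
  vertex Q W -> vertex Q V.
Proof.
move=> eqVW [sQG [projQ minQ]]; exists sQG; split; first exact/eqVW.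
by move=> R sRG sRQ /eqVW; apply: minQ.
Qed.

Lemma divides_Res (gT : finGroupType) (K : fieldType) (G H : {group gT})
    (sHG : H \subset G) (U V : representation K G) :
  divides U V -> divides (Res sHG U) (Res sHG V).
Proof.
move=> /dividesP[A [B [hA hB AB]]]; apply/dividesP; exists A, B; split=> //.
  exact: hom_sub sHG hA.
exact: hom_sub sHG hB.
Qed.

Lemma grepr0_divides (gT : finGroupType) (K : fieldType) (G : {group gT})
  (V : representation K G) : divides (grepr0 : representation K G) V.
Proof.
apply/dividesP; exists 0, 0; split; try exact: hom0.
by rewrite mulmx0; apply/matrixP => -[].
Qed.

(** If X has no Green correspondent, [Gr Q X] is the zero module; otherwise V
    has one as well. *)
Lemma Gr_divides (gT : finGroupType) (K E : fieldType) (f : {rmorphism K -> E})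
    (G Q : {group gT}) (V : representation K G) (X : representation E G) :
  simple V -> vertex Q V -> iso (extend f V) X ->
  divides (Gr Q X) (extend f (Gr Q V)).
Proof.
move=> simV vV VX; have [sQG _] := vV.
rewrite {1}/Gr; case: pselect => [exU | _]; last exact: grepr0_divides.
case: (cid exU) => U /= [indU vU UX].
have UV : divides U (Res (subsetIl G 'N(Q)%g) (extend f V)).
  apply: divides_trans UX _; apply: divides_Res; apply: iso_divides;
    exact: iso_sym.
rewrite /Gr; case: pselect => [exZ | noZ]; last first.
  by case: noZ; apply: exists_green_correspondent sQG _ _ _ _ _ UV.
case: (cid exZ) => Z /= gZ.
exact: (green_correspondent_extend sQG simV vV indU vU UV gZ).
Qed.

Theorem theorem7 (p : nat) (p_prime : prime p)
    (Fbar : closedFieldType) (iota : {rmorphism 'F_p -> Fbar})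
    (iota_algebraic : forall x : Fbar, algebraicOver iota x)
    (gT : finGroupType) (G : {group gT})
    (ITI ITS : forall K : fieldType, set (representation K G))
    (ITI_repr : forall K : fieldType, {rmorphism K -> Fbar} ->
       representatives (@indecomposable gT K G) (ITI K))
    (ITS_repr : forall K : fieldType, {rmorphism K -> Fbar} ->
       representatives (@simple gT K G) (ITS K))
    (ITS_sub_ITI : forall K : fieldType, {rmorphism K -> Fbar} ->
       ITS K `<=` ITI K) :
  exists Sigma : ITS Fbar -> ITS 'F_p,
  [/\ forall X : ITS Fbar,
        unique (fun W : ITS 'F_p => Sigma_rel iota ITI (val X) (val W))
          (Sigma X),
      forall (X : ITS Fbar) (W : ITS 'F_p) (K : divringClosed Fbar)
          (V : representation (subfield K) G) (Q : {group gT}),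
        Sigma X = W -> calE iota ITI (val W) V ->
        iso (extend val V) (val X) -> vertex Q (val W) ->
        [/\ ITS (subfield K) V, vertex Q V, vertex Q (val X),
            forall (SV : representation (subfield K) Q)
                (SX : representation Fbar Q),
              vertex_source_pair V SV -> vertex_source_pair (val X) SX ->
              exists (h : gT) (nQh : h \in 'N(Q)%g),
                h \in 'N_G(Q)%g /\ divides (conj_mod nQh SX) (extend val SV)
          & divides (Gr Q (val X)) (extend val (Gr Q V))],
      forall W : ITS 'F_p, (Sigma @^-1` [set W]) !=set0
    & partition [set: ITS 'F_p] (fun W => Sigma @^-1` [set W])
        [set: ITS Fbar]].
Proof.
have [_ ITSbar_rep _] := ITS_repr Fbar idfun.
have ITSbar_simple (X : ITS Fbar) : simple (val X).
  have [simP _ _] := ITS_repr Fbar idfun; apply: simP; exact: set_valP.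
have ITSp_simple (W : ITS 'F_p) : simple (val W).
  have [simP _ _] := ITS_repr 'F_p iota; apply: simP; exact: set_valP.
(* V is isomorphic to a member of ITS, which lies in ITI, where V is alone in
   its isomorphism type. *)
have ITS_simple_sub (K : divringClosed Fbar)
    (V : representation (subfield K) G) X :
  ITI (subfield K) V -> simple X -> iso (extend val V) X ->
  ITS (subfield K) V.
  move=> IV simX VX; pose v : {rmorphism subfield K -> Fbar} := val.
  have simV : simple V.
    apply: (simple_of_extend (f := v)).
    exact: mx_rsim_irr (mx_rsim_sym VX) simX.
  have [_ repS _] := ITS_repr _ v; have [_ _ injI] := ITI_repr _ v.
  have [V' SV' VV'] := repS V simV.
  by rewrite (injI V V' IV _ (iso_sym VV')) //; apply: (ITS_sub_ITI _ v).
have Sigma_divides X W : Sigma_rel iota ITI X W -> divides X (extend iota W).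
  by case=> K [V [[_ _ VW] VX]]; exact: divides_of_extend VW VX.
have divides_Sigma X W : simple X -> divides X (extend iota W) ->
  Sigma_rel iota ITI X W.
  move=> simX /(divides_finite_subfield p_prime iota_algebraic)[K [V0 [finK V0X
    V0W]]].
  pose v : {rmorphism subfield K -> Fbar} := val.
  have simV0 : simple V0.
    by apply: (simple_of_extend (f := v));
      apply: mx_rsim_irr (mx_rsim_sym V0X) simX.
  have [_ repS _] := ITS_repr _ v; have [V SV V0V] := repS V0 simV0.
  exists K, V; split.
    split=> //; first exact: (ITS_sub_ITI _ v).
    exact: divides_trans (iso_divides V0V) V0W.
  exact: mx_rsim_trans (iso_extend v V0V) V0X.
have unique_W X (W W' : ITS 'F_p) : simple X ->
    divides X (extend iota (val W)) -> divides X (extend iota (val W')) ->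
      W = W'.
  move=> simX XW XW'; have [_ _ inj] := ITS_repr 'F_p iota.
  apply: val_inj; apply: inj; [exact: set_valP | exact: set_valP |].
  exact: divides_extend_unique simX _ _ XW XW'.
have exW (X : ITS Fbar) : exists W : ITS 'F_p,
  Sigma_rel iota ITI (val X) (val W).
  have [W0 simW0 XW0] := exists_divides_extend p_prime iota (ITSbar_simple X).
  have [_ repS _] := ITS_repr 'F_p iota; have [W SW W0W] := repS W0 simW0.
  exists (SigSub (mem_set SW)); apply: divides_Sigma;
    first exact: ITSbar_simple.
  exact: divides_trans XW0 (iso_divides (iso_extend iota (iso_sym W0W))).
have [Sigma SigmaP] := choice exW; exists Sigma.
have surj (W : ITS 'F_p) : (Sigma @^-1` [set W]) !=set0.
  have [X0 simX0 X0W] := exists_divided_by p_prime iota (ITSp_simple W).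
  have [X SX X0X] := ITSbar_rep X0 simX0.
  pose Y : ITS Fbar := SigSub (mem_set SX); exists Y.
  apply: (unique_W X0 (Sigma Y) W simX0 _ X0W).
  exact: divides_trans (iso_divides (iso_sym X0X)) (Sigma_divides _ _
    (SigmaP Y)).
split=> //.
- move=> X; split=> [|W XW]; first exact: SigmaP.
  by apply: (unique_W (val X)) => //; apply: Sigma_divides => //; exact: SigmaP.
- move=> X W K V Q defW [finK IV VW] VX vW.
  pose v : {rmorphism subfield K -> Fbar} := val.
  have SV := ITS_simple_sub K V _ IV (ITSbar_simple X) VX.
  have simV : simple V by have [simP _ _] := ITS_repr _ v; apply: simP.
  have simX := ITSbar_simple X; have simW := ITSp_simple W.
  have XW := divides_of_extend VW VX.
  have vV : vertex Q V.
    apply: vertex_transfer vW => R sRG; split=> [|projW].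
      by apply: rel_projective_simple_extend VW => //;
        have [] := (mx_irrP V).1 simV.
    exact: divides_rel_projective VW (rel_projective_extend _ projW).
  have vX : vertex Q (val X).
    apply: vertex_transfer vW => R sRG; split=> [|projW].
      by apply: rel_projective_simple_extend XW => //;
        have [] := (mx_irrP (val X)).1 simX.
    exact: divides_rel_projective XW (rel_projective_extend _ projW).
  split=> //; last exact: (Gr_divides (f := v)).
  move=> TV TX [_ [indTV [sQG VTV]]] [_ [indTX [sQG' XTX]]].
  rewrite (bool_irrelevance sQG' sQG) in XTX.
  apply: (sources_conj simX vX indTX XTX).
  exact: divides_trans (iso_divides (iso_sym VX)) (extend_Ind v VTV).
split=> [||W _]; last exact: surj.
- by apply/seteqP; split=> // X _; exists (Sigma X).
- by move=> W W' _ _ [X [/= -> ->]].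
Qed.
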